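(* If $W$ is a 1-ended word hyperbolic Coxeter group, then the (Gromov) boundary of $W$ is locally connected.
   Context: A Coxeter group is a group $W$ admitting a finite generating set $S$ with presentation $\langle S : (s_is_j)^{m(i,j)}\rangle$, where $m(i,j)=m(j,i)\in\{1,2,\ldots,\infty\}$, $m(i,j)=1$ iff $i=j$, and the relation is omitted if $m(i,j)=\infty$. *)

(* Defs.v *)
From HB Require Import structures.
From mathcomp Require Import all_boot all_order all_algebra.
From mathcomp Require Import all_classical all_reals all_analysis.

Set Implicit Arguments.
Unset Strict Implicit.
Unset Printing Implicit Defensive.

Import Order.TTheory GRing.Theory Num.Theory.

Local Open Scope classical_set_scope.
Local Open Scope quotient_scope.

(* A letter (i, true) stands for the generator x_i, (i, false) for x_i^-1. *)
Definition word (I : Type) := seq (I * bool).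

(* Equality in the quotient of the free group on I by the normal closure of
   the relators R. *)
Inductive pres_eq (I : Type) (R : set (word I)) : word I -> word I -> Prop :=
| pres_refl u : pres_eq R u u
| pres_sym u v : pres_eq R u v -> pres_eq R v u
| pres_trans u v w : pres_eq R u v -> pres_eq R v w -> pres_eq R u w
| pres_cancel u v i b : pres_eq R (u ++ (i, b) :: (i, ~~ b) :: v) (u ++ v)
| pres_rel u v r : R r -> pres_eq R (u ++ r ++ v) (u ++ v).

Definition word_eval (W : groupType) (I : Type) (s : I -> W) (w : word I) : W :=
  (\prod_(x <- w) (if x.2 then s x.1 else (s x.1)^-1))%g.

(* The map x_i |-> s i induces an isomorphism from < I | R > onto W. *)
Definition presented_by (W : groupType) (I : Type) (s : I -> W)
    (R : set (word I)) : Prop :=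
  (forall g : W, exists w, word_eval s w = g) /\
  (forall u v, word_eval s u = word_eval s v <-> pres_eq R u v).

(* None encodes m(i, j) = oo. *)
Definition coxeter_matrix (n : nat) (m : 'I_n -> 'I_n -> option nat) : Prop :=
  [/\ forall i j, m i j = m j i,
      forall i j, m i j <> Some 0 &
      forall i j, m i j = Some 1 <-> i = j].

Definition coxeter_relators (n : nat) (m : 'I_n -> 'I_n -> option nat) :
    set (word 'I_n) :=
  [set r | exists i j k, m i j = Some k /\
                         r = flatten (nseq k [:: (i, true); (j, true)])].

Definition coxeter_group (W : groupType) : Prop :=
  exists (n : nat) (s : 'I_n -> W) (m : 'I_n -> 'I_n -> option nat),
    coxeter_matrix m /\ presented_by s (coxeter_relators m).

Definition word_over (W : groupType) (A : seq W) (w : seq W) : bool :=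
  all (fun x => (x \in A) || ((x^-1)%g \in A)) w.

Record genset (W : groupType) := Genset {
  gens :> seq W;
  gensP : forall g : W, exists w, word_over gens w /\ (\prod_(x <- w) x)%g = g
}.

Section WordMetric.
Context {W : groupType} (A : genset W).

Definition has_length (g : W) : pred nat := fun n =>
  `[< exists w, [/\ size w = n, word_over A w & (\prod_(x <- w) x)%g = g] >].

Lemma has_length_ex g : exists n, has_length g n.
Proof.
by have [w [wA wg]] := gensP A g; exists (size w); apply/asboolP; exists w.
Qed.

Definition word_length (g : W) : nat := ex_minn (has_length_ex g).

Definition word_dist (g h : W) : nat := word_length (g^-1 * h)%g.

Definition cayley_adj (g h : W) : bool := word_dist g h == 1.

Definition gromov_product (x y w : W) : rat :=
  (((word_dist x w)%:R + (word_dist y w)%:R - (word_dist x y)%:R) / 2)%R.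

(* Gromov's four-point condition, for the word metric. *)
Definition hyperbolic : Prop :=
  exists delta : rat, forall x y z w : W,
    (Num.min (gromov_product x y w) (gromov_product y z w) - delta
       <= gromov_product x z w)%R.

(* Edge paths represent all proper rays of the Cayley graph up to the relation
   of converging to the same end. *)
Definition proper_ray (r : nat -> W) : Prop :=
  (forall n, cayley_adj (r n) (r n.+1)) /\
  (forall K : seq W, exists N, forall n, N <= n -> r n \notin K).

Definition connected_off (K : seq W) (g h : W) : Prop :=
  exists p : seq W, [/\ path cayley_adj g p, last g p = h &
                        all (fun x => x \notin K) (g :: p)].

Definition same_end (r s : nat -> W) : Prop :=
  forall K : seq W, exists N, forall m n, N <= m -> N <= n ->
    connected_off K (r m) (s n).

Definition exactly_one_end : Prop :=
  (exists r, proper_ray r) /\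
  (forall r s, proper_ray r -> proper_ray s -> same_end r s).

(* A geodesic ray of the Cayley graph issuing from the vertex 1 is determined by
   its vertices at integer times.  For such rays pointwise convergence of the
   vertices is uniform convergence on compact sets, so the quotient by
   [asymptotic] carries the usual topology of the Gromov boundary. *)
Definition geodesic_rays : set {ptws nat -> discrete_topology W} :=
  [set r | r 0 = 1%g /\ forall m n, m <= n -> word_dist (r m) (r n) = n - m].

Definition asymptotic (r s : geodesic_rays) : bool :=
  `[< exists C, forall n, word_dist (set_val r n) (set_val s n) <= C >].

Lemma word_length1 : word_length 1%g = 0.
Proof.
rewrite /word_length; case: ex_minnP => n _ /(_ 0).
by rewrite leqn0 => H; apply/eqP/H/asboolP; exists [::]; rewrite big_nil.
Qed.

Lemma word_lengthP g :
  exists w, [/\ size w = word_length g, word_over A w &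
                (\prod_(x <- w) x)%g = g].
Proof. by rewrite /word_length; case: ex_minnP => n /asboolP. Qed.

Lemma word_length_min g w :
  word_over A w -> (\prod_(x <- w) x)%g = g -> word_length g <= size w.
Proof.
move=> wA wg; rewrite /word_length; case: ex_minnP => n _; apply.
by apply/asboolP; exists w.
Qed.

Lemma word_lengthV g : word_length (g^-1)%g <= word_length g.
Proof.
have [w [<- wA wg]] := word_lengthP g.
rewrite -(size_rev w) -(size_map (fun x => x^-1)%g (rev w)).
apply: word_length_min; last by rewrite big_map prodgV revK wg.
rewrite /word_over all_map all_rev; apply: sub_all wA => x /=.
by rewrite invgK orbC.
Qed.

Lemma word_lengthM g h : word_length (g * h)%g <= word_length g + word_length h.
Proof.
have [u [<- uA ug]] := word_lengthP g; have [v [<- vA vh]] := word_lengthP h.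
rewrite -size_cat; apply: word_length_min; last by rewrite big_cat /= ug vh.
by rewrite /word_over all_cat; apply/andP.
Qed.

Lemma word_distC g h : word_dist g h = word_dist h g.
Proof.
by apply/eqP; rewrite eqn_leq /word_dist -{1}(invgK h) -{3}(invgK g);
  rewrite -!invgM !word_lengthV.
Qed.

Lemma word_dist_triangle g h k : word_dist g k <= word_dist g h + word_dist h k.
Proof.
rewrite /word_dist; apply: leq_trans (word_lengthM _ _).
by rewrite mulgA mulgK.
Qed.

Lemma asymptotic_refl : reflexive asymptotic.
Proof.
by move=> r; apply/asboolP; exists 0 => n; rewrite /word_dist mulVg word_length1.
Qed.

Lemma asymptotic_sym : symmetric asymptotic.
Proof.
move=> r s; apply/asboolP/asboolP => -[C rs]; exists C => n;
  by rewrite word_distC.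
Qed.

Lemma asymptotic_trans : transitive asymptotic.
Proof.
move=> s r t /asboolP[C rs] /asboolP[D st]; apply/asboolP; exists (C + D) => n.
exact: leq_trans (word_dist_triangle _ _ _) (leq_add (rs n) (st n)).
Qed.

Canonical asymptotic_equiv :=
  EquivRel asymptotic asymptotic_refl asymptotic_sym asymptotic_trans.

Definition gromov_boundary : topologicalType :=
  quotient_topology {eq_quot asymptotic_equiv}.

End WordMetric.

Definition word_hyperbolic (W : groupType) : Prop :=
  exists A : genset W, hyperbolic A.

Definition one_ended (W : groupType) : Prop :=
  exists A : genset W, exactly_one_end A.

Definition locally_connected (T : topologicalType) : Prop :=
  forall (x : T) (U : set T), nbhs x U ->
    exists V : set T, [/\ open V, V x, connected V & V `<=` U].

(* Main.v *)
Require Import Defs.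
From mathcomp Require Import all_boot all_order all_algebra.
From mathcomp Require Import all_classical all_reals all_analysis.
From mathcomp Require Import zify lra.

(* Let l be the length for the Coxeter generators S and call s in S an ascent at g
   if l(gs) > l(g).  The other generators generate a finite subgroup, so if the
   ascents at g fell into two classes with every product across them of infinite
   order, then W would split over that finite subgroup, against one-endedness.
   If s, t are ascents at g and st has finite order, then gs and gt are joined by
   the rest of the dihedral coset of g, all of whose elements lie above g on
   geodesics from 1 through g.  Hence a path in the cone of g (the vertices h with
   a geodesic from 1 to h through g) can be pushed away from its local minima, so
   each cone is connected above each level.  By hyperbolicity rays through adjacent
   vertices fellow travel up to these, so a limiting argument shows that the shadow
   of g, the set of endpoints of rays from 1 through g, is connected; it is also
   closed.  The shadows of level n containing a boundary point p form a connected
   neighbourhood of p, and it shrinks to p as n grows.  The Morse lemma allows to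
   use three different generating sets: S, a hyperbolic one, and the one defining
   the boundary. *)

Set Implicit Arguments.
Unset Strict Implicit.
Unset Printing Implicit Defensive.

Import Order.TTheory GRing.Theory Num.Theory.

Local Open Scope classical_set_scope.
Local Open Scope quotient_scope.

(** * Quasigeodesics in hyperbolic metric spaces *)

(** In the Morse lemma a path of length linear in M is cut into at most [2 ^ k] steps at a cost
    linear in k. This makes that cost smaller than M once M is large. *)
Lemma exp2_dominates_linear (a b c e : nat) :
  exists M0, forall M, M0 <= M -> exists k, b * M + c <= 2 ^ k /\ a * k + e < M.
Proof.
have lin_exp u v : exists h0, forall h, h0 <= h -> u * h + v <= 2 ^ h.
  exists ((u + v).*2.*2.+2) => h hh.
  (* Splitting the exponent into halves bounds [2 ^ h] below by a quadratic in h. *)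
  have h2 : h = h./2 + uphalf h by rewrite addnC uphalf_half -addnA addnn addnC
    -{1}(odd_double_half h) addnC.
  have e1 := ltn_expl h./2 (isT : 1 < 2).
  have e2 := ltn_expl (uphalf h) (isT : 1 < 2).
  rewrite {2}h2 expnD; apply: leq_trans (leq_mul e1 e2).
  have hb : h./2 <= uphalf h by rewrite uphalf_half leq_addl.
  have ha : (u + v).*2 <= h./2 by lia.
  rewrite {1}h2; nia.
have [h0 H] := lin_exp (b * a.+1) (b * (a.+1 * e.+2) + c).
exists (a.+1 * (h0 + e.+2)) => M hM.
(* k grows linearly in M, yet (a+1)(k+e+1) <= M leaves room for a k + e. *)
pose k := M %/ a.+1 - e.+1.
have kq : h0 < M %/ a.+1 - e.+1 by rewrite ltn_subRL leq_divRL //; nia.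
exists k; split.
  have := H k (ltnW kq).
  have := ltn_ceil M (ltn0Sn a).
  have -> : (M %/ a.+1) = k + e.+1 by rewrite /k; lia.
  nia.
have := leq_trunc_div M a.+1.
have : M %/ a.+1 = k + e.+1 by rewrite /k; lia.
move=> ->; nia.
Qed.

Section Hyperbolic.
Variables (W : Type) (d : W -> W -> nat).
Hypothesis d0 : forall x, d x x = 0.
Hypothesis dC : forall x y, d x y = d y x.
Hypothesis dT : forall x y z, d x z <= d x y + d y z.

Definition geodesic (n : nat) (c : nat -> W) :=
  forall i j, i <= j -> j <= n -> d (c i) (c j) = j - i.

Hypothesis geodesic_ex : forall x y,
  exists c, [/\ c 0 = x, c (d x y) = y & geodesic (d x y) c].

(** Gromov's inequality multiplied by 2, with the minimum turned into a disjunction, to stay in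
    [nat]; D plays the role of 2 delta. *)
Definition four_point (D : nat) := forall x y z w,
  (d x z + d y w <= d x y + d z w + D) || (d x z + d y w <= d y z + d x w + D).

Variable D : nat.
Hypothesis hypD : four_point D.

(* Twice the Gromov product, so that it is a natural number. *)
Definition gp w x y := d x w + d y w - d x y.

Lemma gpC w x y : gp w x y = gp w y x.
Proof. by rewrite /gp addnC (dC x y). Qed.

Lemma gp_min w x y z m : m <= gp w x y -> m <= gp w y z -> m <= gp w x z + D.
Proof.
rewrite /gp; have := hypD x y z w; have := dT x w y; have := dT y w z.
rewrite (dC w y) (dC w z); move=> t1 t2 /orP[]; lia.
Qed.

(** Dyadic subdivision: each halving of the chain uses [gp_min] once and costs D. *)
Lemma gp_chain w k n (x : nat -> W) m : 0 < n -> n <= 2 ^ k ->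
  (forall i, i < n -> m <= gp w (x i) (x i.+1)) ->
  m <= gp w (x 0) (x n) + k * D.
Proof.
elim: k n x m => [|k IH] n x m n0 nk H.
  have -> : n = 1 by move: nk; rewrite expn0; lia.
  by rewrite mul0n addn0; apply: H.
have [nk'|nk'] := leqP n (2 ^ k); first by have := IH n x m n0 nk' H; nia.
have p0 : 0 < 2 ^ k by rewrite expn_gt0.
have h1 := IH (2 ^ k) x m p0 (leqnn _) (fun i hi => H i (ltn_trans hi nk')).
have h2 : m <= gp w (x (2 ^ k)) (x n) + k * D.
  have /= := IH (n - 2 ^ k) (fun i => x (2 ^ k + i)) m.
  rewrite addn0 (subnKC (ltnW nk')); apply; rewrite ?subn_gt0 //.
    by move: nk; rewrite expnS; lia.
  by move=> i hi; rewrite ?addnS; apply: H; lia.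
have := @gp_min w (x 0) (x (2 ^ k)) (x n) (m - k * D).
rewrite mulSn; lia.
Qed.

Definition quasigeodesic (l n : nat) (p : nat -> W) :=
  forall i j, i <= j -> j <= n ->
    d (p i) (p j) <= l * (j - i) /\ j - i <= l * d (p i) (p j).

Lemma gp_far w x y r e : r <= d x w -> r <= d y w -> d x y <= e ->
  r.*2 - e <= gp w x y.
Proof. by rewrite /gp; lia. Qed.

(* The hypothesis on [k] says |i - j| <= k. *)
Lemma gp_segment l n p w r i j : quasigeodesic l n p ->
  (forall k, k <= n -> r <= d w (p k)) -> i <= n -> j <= n ->
  forall k m, j + i <= k + (minn i j).*2 -> k <= 2 ^ m -> 
  r.*2 - l <= gp w (p i) (p j) + m * D.
Proof.
move=> qp far; wlog ij : i j / i <= j.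
  move=> H hi hj k m kij km; case: (leqP i j) => ij; first exact: H kij km.
  have := H j i (ltnW ij) hj hi k m.
  by rewrite addnC minnC => /(_ kij km); rewrite gpC.
move=> hi hj k m; rewrite (minn_idPl ij) => kij km.
have [eij|nij] := eqVneq i j.
  subst j; rewrite /gp d0 subn0; have := far i hi; rewrite dC; lia.
have := @gp_chain w m (j - i) (fun a => p (i + a)) (r.*2 - l).
rewrite addn0 subnKC //; apply; [lia|lia|].
move=> a ha; rewrite addnS; apply: gp_far.
- by rewrite dC; apply: far; lia.
- by rewrite dC; apply: far; lia.
- by have [] := qp (i + a) (i + a).+1 (leqnSn _); [lia | nia].
Qed.

(** Let w on c be as far as possible from p, at distance M. The points of c at distance 2M on either
    side of w are close to p, and the stretch of p between them has length O(M) and avoids the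
    M-ball about w. By [gp_segment] their Gromov product at w is at least 2M - O(log M), but it
    vanishes since w lies between them on c. *)
Lemma morse_geodesic (l : nat) : exists M, forall n p L c,
  quasigeodesic l n p -> geodesic L c -> c 0 = p 0 -> c L = p n ->
  forall t, t <= L -> exists2 i, i <= n & d (c t) (p i) <= M.
Proof.
have [M0 HM0] := exp2_dominates_linear D (l * 6) 1 (l + D + D).
exists M0 => n p L c qp gc c0 cL.
pose P v := [exists t : 'I_L.+1, [forall i : 'I_n.+1, v <= d (c t) (p i)]].
have P0 : exists v, P v by exists 0; apply/existsP; exists ord0; apply/forallP.
have PL v : P v -> v <= L.
  move=> /existsP[t /forallP/(_ ord0)]; rewrite -c0 dC gc //; have := ltn_ord t; lia.
have [M /existsP[t0 /forallP far] maxM] := ex_maxnP P0 PL.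
have near t : t <= L -> exists2 i, i <= n & d (c t) (p i) <= M.
  move=> tL; have : ~~ P M.+1 by apply/negP => /maxM; rewrite ltnn.
  move/existsPn/(_ (Ordinal (tL : t < L.+1)))/forallPn => [i].
  by rewrite -ltnNge ltnS => h; exists i => //; rewrite -ltnS.
have [MM|MM] := leqP M M0.
  by move=> t /near[i hi h]; exists i => //; apply: leq_trans MM.
exfalso; have {}far i : i <= n -> M <= d (c t0) (p i).
  by move=> hi; apply: (far (Ordinal (hi : i < n.+1))).
set w := c t0 in far; have t0L : t0 <= L by rewrite -ltnS.
(* Where c is too short to go 2M away from w, its endpoint is used instead; that one lies on p. *)
have end_gp t : t <= L -> (t = t0 - M.*2 \/ t = minn (t0 + M.*2) L) ->
    exists i, [/\ i <= n, d (c t) (p i) <= M & M.*2 <= gp w (c t) (p i)].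
  move=> tL ht.
  have [i hi [di|[ti ee]]] : exists2 i, i <= n & d (c t) (p i) <= M /\ M.*2 <= d (c t) w
      \/ d (c t) (p i) = 0 /\ c t = p i.
    have [i hi di] := near t tL.
    have [big|small] := leqP M.*2 (d (c t) w); first by exists i => //; left.
    have [t00|tt] := eqVneq t 0; first by exists 0 => //; right; rewrite t00 c0 d0.
    have [tLL|tt'] := eqVneq t L; first by exists n => //; right; rewrite tLL cL d0.
    exists i => //; left; split => //; case: ht => ht.
      by move: small; rewrite /w gc; lia.
    by move: small; rewrite /w dC gc; lia.
  - case: di => di big; exists i; split => //; rewrite /gp.
    have := far i hi; rewrite (dC w); lia.
  exists i; split; rewrite ?ti // ee /gp d0 subn0 dC; have := far i hi; lia.
have [i1 [hi1 d1 g1]] := end_gp (t0 - M.*2) ltac:(lia) (or_introl erefl).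
have [i2 [hi2 d2 g2]] := end_gp (minn (t0 + M.*2) L) ltac:(lia) (or_intror erefl).
have d12 : d (p i1) (p i2) <= 6 * M.
  have := dT (p i1) (c (t0 - M.*2)) (p i2).
  have := dT (c (t0 - M.*2)) (c (minn (t0 + M.*2) L)) (p i2).
  rewrite (dC (p i1) (c _)) (gc (t0 - _)); lia.
have e12 : i2 + i1 <= l * 6 * M + (minn i1 i2).*2.
  have [ij|ij] := leqP i1 i2.
    by have [_ h] := qp _ _ ij hi2; nia.
  by have [_] := qp _ _ (ltnW ij) hi1; rewrite dC => h; nia.
have [k [hk1 hk2]] := HM0 M (ltnW MM).
have g3 := gp_segment qp far hi1 hi2 e12 (leq_trans (leq_addr 1 _) hk1).
have gz : gp w (c (t0 - M.*2)) (c (minn (t0 + M.*2) L)) = 0.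
  by rewrite /gp (dC (c (minn _ _)) w) /w !gc; lia.
have a1 := @gp_min w (c (t0 - M.*2)) (p i1) (p i2) (M.*2 - l - k * D) ltac:(lia) ltac:(lia).
have g2' : M.*2 <= gp w (p i2) (c (minn (t0 + M.*2) L)).
  by rewrite gpC.
have := @gp_min w (c (t0 - M.*2)) (p i2) (c (minn (t0 + M.*2) L))
  (M.*2 - l - k * D - D) ltac:(lia) ltac:(lia).
rewrite gz; nia.
Qed.

Lemma morse_quasigeodesic (l : nat) : exists M, forall n p L c,
  quasigeodesic l n p -> geodesic L c -> c 0 = p 0 -> c L = p n ->
  forall i, i <= n -> exists2 t, t <= L & d (p i) (c t) <= M.
Proof.
have [M HM] := morse_geodesic l.
exists (l * (l * M.*2.+1) + M) => n p L c qp gc c0 cL t tn.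
have near := HM n p L c qp gc c0 cL.
pose P u := (u <= L) && [exists i : 'I_n.+1, (i <= t) && (d (c u) (p i) <= M)].
have exP : exists u, P u.
  by exists 0; apply/andP; split => //; apply/existsP; exists ord0; rewrite /= c0 d0.
have PL u : P u -> u <= L by case/andP.
have [u /andP[uL /existsP[i /andP[it di]]] maxu] := ex_maxnP exP PL.
exists u => //.
have close j : t <= j -> j <= n -> d (p i) (p j) <= M.*2.+1 ->
    d (p t) (c u) <= l * (l * M.*2.+1) + M.
  move=> tj jn dij; have [_ h1] := qp i j (leq_trans it tj) jn.
  have [h2 _] := qp i t it tn.
  have := dT (p t) (p i) (c u); rewrite (dC (p t) (p i)) (dC (p i) (c u)).
  have : l * (t - i) <= l * (l * M.*2.+1) by rewrite leq_mul2l; apply/orP; right; nia.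
  lia.
have [uL'|uL'] := ltnP u L.
  have [j jn dj] := near u.+1 uL'.
  have tj : t < j.
    rewrite ltnNge; apply/negP => jt; have := maxu u.+1; rewrite ltnn => H.
    suff /H : P u.+1 by [].
    by rewrite /P uL'; apply/existsP; exists (Ordinal (jn : j < n.+1)); rewrite /= jt dj.
  apply: (close j) => //; first exact: ltnW.
  have := dT (p i) (c u) (p j); have := dT (c u) (c u.+1) (p j).
  by rewrite (gc u) // (dC (p i) (c u)); lia.
apply: (close n) => //.
have eu : u = L by lia.
by rewrite -cL dC -eu; lia.
Qed.

(** Pass from p i to a point c u of a geodesic, from there to c' u on a geodesic with the endpoints
    of q, then to q. The middle step is the four-point condition along c u, p n, q m, c' u; the
    distance of p i from p n keeps u below both lengths. *)
Lemma fellow_travel (l : nat) : exists H, forall n p m q e,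
  quasigeodesic l n p -> quasigeodesic l m q -> p 0 = q 0 ->
  d (p n) (q m) <= e -> forall i, i <= n -> H + e < d (p i) (p n) ->
  exists2 j, j <= m & d (p i) (q j) <= H.
Proof.
have [M1 H1] := morse_geodesic l; have [M2 H2] := morse_quasigeodesic l.
exists (M2 + D.*2 + M1) => n p m q e qp qq pq0 en i hi far.
have [c [c0 cL gc]] := geodesic_ex (p 0) (p n).
have [c' [c'0 cL' gc']] := geodesic_ex (q 0) (q m).
set L := d (p 0) (p n) in cL gc; set L' := d (q 0) (q m) in cL' gc'.
have [u uL du] := H2 n p L c qp gc c0 cL i hi.
have LL' : L <= L' + e.
  by rewrite /L /L' pq0; have := dT (q 0) (q m) (p n); rewrite (dC (q m)); lia.
have L'L : L' <= L + e by rewrite /L /L' pq0; have := dT (q 0) (p n) (q m); lia.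
have ue : u + e <= L.
  have := dT (p i) (c u) (p n); rewrite -cL gc //; move: far; rewrite -cL; lia.
have [j jm dj] := H1 m q L' c' qq gc' c'0 cL' u ltac:(lia).
exists j => //.
have o1 : u.*2 <= gp (c 0) (c u) (p n).
  by rewrite /gp -cL (dC (c u) (c 0)) (dC (c L)) !gc //; lia.
have o2 : u.*2 <= gp (c 0) (p n) (q m).
  rewrite /gp -{1}cL (dC (c L)) gc // c0 pq0 -c'0 -{1}cL' (dC (c' L')) gc' //; lia.
have o3 : u.*2 <= gp (c 0) (q m) (c' u).
  rewrite /gp c0 pq0 -c'0 -cL' !(dC _ (c' 0)) (dC (c' L')) !gc' //; lia.
have g1 := gp_min o1 o2.
have := @gp_min (c 0) (c u) (q m) (c' u) (u.*2 - D) ltac:(lia) ltac:(lia).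
have cu0 : d (c u) (c 0) = u by rewrite dC gc // subn0.
have cu'0 : d (c' u) (c 0) = u.
  by rewrite c0 pq0 -c'0 dC gc' // ?subn0 //; lia.
rewrite {1}/gp cu0 cu'0 => g2.
have := dT (p i) (c u) (q j); have := dT (c u) (c' u) (q j).
have := dT (c u) (c 0) (c' u); rewrite cu0 (dC (c 0)) cu'0; lia.
Qed.

End Hyperbolic.

(** * Geodesic rays for different generating sets *)

(** Compactness of a product of finite sets: index by index, fix a value taken for infinitely many
    of the remaining k. *)
Lemma cluster_sequence (T : choiceType) (f : nat -> nat -> T) :
  (forall i, exists s : seq T, forall k, f k i \in s) ->
  exists g : nat -> T, forall N M, exists k, M <= k /\ forall i, i <= N -> f k i = g i.
Proof.
move=> fin.
pose inf (P : nat -> Prop) := forall M, exists k, M <= k /\ P k.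
have pigeonhole (P : nat -> Prop) i : inf P -> exists v, inf (fun k => P k /\ f k i = v).
  move=> infP; have [s fs] := fin i.
  have : inf (fun k => P k /\ f k i \in s).
    by move=> M; have [k [? ?]] := infP M; exists k.
  elim: s {fs} => [|v s IH] H; first by have [k [_ []]] := H 0.
  have [yes|no] := pselect (inf (fun k => P k /\ f k i = v)); first by exists v.
  have {no} [M0 HM0] : exists M0, forall k, M0 <= k -> P k -> f k i <> v.
    apply: contrapT => no'; apply: no => M; apply: contrapT => noM; apply: no'.
    by exists M => k Mk Pk e; apply: noM; exists k.
  apply: IH => M; have [k [hk [Pk]]] := H (maxn M M0).
  rewrite inE => /orP[/eqP e|kin]; last by exists k; split => //; lia.
  by case: (HM0 k _ Pk e); lia.
have [F HF] : exists F : (nat -> Prop) * nat -> T,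
    forall P i, inf P -> inf (fun k => P k /\ f k i = F (P, i)).
  have [F HF] := @choice ((nat -> Prop) * nat) T
    (fun z v => inf z.1 -> inf (fun k => z.1 k /\ f k z.2 = v))
    (fun z => ltac:(have [h|h] := pselect (inf z.1);
      [have [v hv] := pigeonhole _ z.2 h; by exists v | by exists (f 0 0)])).
  by exists F => P i; apply: (HF (P, i)).
(* [Q n] holds of the k that take the chosen values at all indices below n. *)
pose fix Q n : nat -> Prop :=
  if n is n'.+1 then fun k => Q n' k /\ f k n' = F (Q n', n') else fun=> True.
have infQ n : inf (Q n) by elim: n => [|n IH] M /=; [exists M | exact: HF].
exists (fun n => F (Q n, n)) => N M.
have [k [Mk Qk]] := infQ N.+1 M; exists k; split => // i iN.
have : forall n, Q n k -> forall i, i < n -> f k i = F (Q i, i).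
  elim=> [|n IH] //= [Qn e] j; rewrite ltnS leq_eqVlt => /orP[/eqP->//|].
  exact: IH.
by apply; [exact: Qk | rewrite ltnS].
Qed.

Section WordMetric.
Context {W : groupType}.
Implicit Types (A B : genset W) (g h x y : W) (r : nat -> W).

Lemma word_dist0 A x : word_dist A x x = 0.
Proof. by rewrite /word_dist mulVg word_length1. Qed.

Lemma word_length_eq0 A g : word_length A g = 0 -> g = 1%g.
Proof.
have [w [sw _ wg]] := word_lengthP A g.
by rewrite -sw -wg => /size0nil ->; rewrite big_nil.
Qed.

Lemma word_distMl A k x y : word_dist A (k * x)%g (k * y)%g = word_dist A x y.
Proof. by rewrite /word_dist invgM -mulgA mulKg. Qed.

Lemma word_dist1 A x : word_dist A 1%g x = word_length A x.
Proof. by rewrite /word_dist invg1 mul1g. Qed.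

Lemma word_lengthVE A g : word_length A (g^-1)%g = word_length A g.
Proof. by apply/eqP; rewrite eqn_leq word_lengthV -{1}(invgK g) word_lengthV. Qed.

Lemma word_dist_path A l n r : (forall i, i < n -> word_dist A (r i) (r i.+1) <= l) ->
  forall i j, i <= j -> j <= n -> word_dist A (r i) (r j) <= l * (j - i).
Proof.
move=> H i j; elim: j => [|j IH] ij jn.
  have -> : i = 0 by lia.
  by rewrite word_dist0.
have [->|ne] := eqVneq i j.+1; first by rewrite word_dist0.
have ij' : i <= j by lia.
have := word_dist_triangle A (r i) (r j) (r j.+1).
have := IH ij' (ltnW jn); have := H j jn.
by rewrite (subSn ij') mulnS; lia.
Qed.

Definition word_path x (w : seq W) i := (x * \prod_(y <- take i w) y)%g.

Lemma word_path_dist A x w : word_over A w ->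
  forall i j, i <= j -> word_dist A (word_path x w i) (word_path x w j) <= j - i.
Proof.
move=> wA i j ij; rewrite /word_path word_distMl /word_dist.
have -> : take j w = take i w ++ take (j - i) (drop i w).
  by rewrite -takeD subnKC.
rewrite big_cat /= mulKg; apply: leq_trans (word_length_min (w := take (j - i) (drop i w)) _ erefl) _.
  by apply/allP => z /mem_take /mem_drop; apply: (allP wA).
by rewrite size_take; case: ltnP => // _; lia.
Qed.

Lemma word_geodesic A x y : exists c,
  [/\ c 0 = x, c (word_dist A x y) = y & geodesic (word_dist A) (word_dist A x y) c].
Proof.
have [w [sw wA wg]] := word_lengthP A (x^-1 * y)%g.
exists (word_path x w); rewrite /word_path take0 big_nil mulg1.
have e : (x * \prod_(j <- take (word_dist A x y) w) j)%g = y.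
  by rewrite take_oversize /word_dist ?sw // wg mulVKg.
split=> // i j ij jn.
have h1 := word_path_dist x wA ij; have h2 := word_path_dist x wA (leq0n i).
have h3 := word_path_dist x wA jn.
have := word_dist_triangle A x (word_path x w i) y.
have := word_dist_triangle A (word_path x w i) (word_path x w j) y.
move: h1 h2 h3; rewrite /word_path take0 big_nil mulg1 e; lia.
Qed.

Lemma word_length_lipschitz A B : exists l, forall g, word_length B g <= l * word_length A g.
Proof.
exists (\max_(x <- A) word_length B x) => g.
have [w [<- wA <-]] := word_lengthP A g.
elim: w wA => [|x w IH] /=; first by rewrite big_nil word_length1.
case/andP => xA wA; rewrite big_cons mulnS.
apply: leq_trans (word_lengthM _ _ _) (leq_add _ (IH wA)).
case/orP: xA => xA; first exact: leq_bigmax_seq.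
by rewrite -word_lengthVE; apply: leq_bigmax_seq.
Qed.

Lemma word_dist_lipschitz A B : exists l, forall x y,
  word_dist B x y <= l * word_dist A x y.
Proof. by have [l hl] := word_length_lipschitz A B; exists l => x y; apply: hl. Qed.

(** The constant is only bounded below, so that several generating sets can share one l. *)
Lemma geodesic_quasigeodesic A B : exists l0, forall l n r, l0 <= l ->
  geodesic (word_dist B) n r -> quasigeodesic (word_dist A) l n r.
Proof.
have [l1 h1] := word_dist_lipschitz A B; have [l2 h2] := word_dist_lipschitz B A.
exists (l1 + l2) => l n r hl geo i j ij jn.
have := h1 (r i) (r j); have := h2 (r i) (r j); rewrite geo // => a b.
split; [apply: leq_trans a _|apply: leq_trans b _]; rewrite leq_mul2r; lia.
Qed.

Lemma word_ball_finite A n : exists s : seq W, forall g, word_length A g <= n -> g \in s.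
Proof.
exists (iter n (fun s => s ++ [seq (g * x)%g | g <- s, x <- A ++ [seq (x^-1)%g | x <- A]])
  [:: 1%g]) => g.
have [w [<- wA <-]] := word_lengthP A g => {g}.
elim: n w wA => [|n IH] w wA.
  by rewrite leqn0 size_eq0 => /eqP->; rewrite big_nil mem_seq1.
elim/last_ind: w wA => [|w x _].
  by move=> _ _; rewrite iterS mem_cat IH.
rewrite /word_over all_rcons => /andP[xA wA]; rewrite size_rcons ltnS => sw.
rewrite -cats1 big_cat big_seq1 iterS mem_cat; apply/orP; right.
apply/allpairsP; exists ((\prod_(y <- w) y)%g, x); split => //=; first exact: IH.
rewrite mem_cat; apply/orP; case/orP: xA => xA; [by left | right].
by apply/mapP; exists (x^-1)%g; rewrite ?invgK.
Qed.

Definition ray A r := r 0 = 1%g /\ forall n, geodesic (word_dist A) n r.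

Lemma ray_length A r : ray A r -> forall n, word_length A (r n) = n.
Proof. by move=> [r0 gr] n; rewrite -word_dist1 -r0 (gr n) // subn0. Qed.

(** * Quasigeodesic rays in a hyperbolic group *)

Section Hyperbolic.
Variable A : genset W.
Hypothesis hypA : hyperbolic A.

Lemma hyperbolic_four_point : exists D, four_point (word_dist A) D.
Proof.
have [delta hd] := hypA.
(* The absolute value covers a negative [delta]. *)
pose D := absz (Num.ceil (2 * delta)%R); exists D => x y z w.
have hD : (2 * delta <= D%:R)%R.
  apply: le_trans (ceil_ge _) _; rewrite (pmulrn 1%R D) ler_int; exact: lez_abs.
have := hd x y z w; rewrite /gromov_product.
rewrite lerBlDr ge_min -!(ler_nat rat) !natrD => /orP[] h; apply/orP; [left|right]; lra.
Qed.

Local Notation d := (word_dist A).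

Definition qray l r := r 0 = 1%g /\ forall n, quasigeodesic d l n r.

(** Not synchronised in time, since geodesic rays for different generating sets run at different
    speeds in the metric of A. *)
Definition close H r r' := forall i, exists j, d (r i) (r' j) <= H.
Definition asym r r' := exists H, close H r r'.

Lemma ray_qray B : exists l0, forall l r, l0 <= l -> ray B r -> qray l r.
Proof.
have [l0 h] := geodesic_quasigeodesic A B; exists l0 => l r hl [r0 gr].
by split => // n; apply: h.
Qed.

Lemma qray_expand l r : qray l r -> forall i e, exists N, forall n, N <= n ->
  e < d (r i) (r n).
Proof.
move=> [_ qr] i e; exists (i + l * e + 1) => n hn.
have [_] := qr n i n ltac:(lia) (leqnn _).
rewrite ltnNge => h; apply/negP => h2; have := leq_mul (leqnn l) h2; lia.
Qed.

Lemma qray_segment_fellow_travel l : exists H, forall n p m q e,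
  quasigeodesic d l n p -> quasigeodesic d l m q -> p 0 = q 0 ->
  d (p n) (q m) <= e -> forall i, i <= n -> H + e < d (p i) (p n) ->
  exists2 j, j <= m & d (p i) (q j) <= H.
Proof.
have [D hD] := hyperbolic_four_point.
by have := fellow_travel (word_dist0 A) (word_distC A) (word_dist_triangle A)
  (word_geodesic A) hD l.
Qed.

(** Two rays that come within any fixed distance of each other arbitrarily far out fellow travel all
    the way, with a constant depending on l only. *)
Lemma asym_close l : exists H, forall r r', qray l r -> qray l r' -> asym r r' ->
  close H r r' /\ close H r' r.
Proof.
have [H HH] := qray_segment_fellow_travel l; exists H => r r' qr qr' [D cD].
have main p q : qray l p -> qray l q ->
    (forall N, exists i j, N <= i /\ d (p i) (q j) <= D) -> close H p q.
  move=> qp qq hD i; have [N hN] := qray_expand qp i (H + D).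
  have [n [m [Nn dnm]]] := hD (maxn i N).
  have pq0 : p 0 = q 0 by rewrite qp.1 qq.1.
  have [||j _ hj] := HH n p m q D (qp.2 n) (qq.2 m) pq0 dnm i.
  - by lia.
  - by apply: hN; lia.
  by exists j.
split; apply: main => // N; first by have [j hj] := cD N; exists N, j.
(* So far out on r, the matching index on r' is at least N, which gives far meeting points on r' as
   well. *)
have [N' hN'] := qray_expand qr 0 (l * N + D).
have [j hj] := cD N'; exists j, N'; rewrite word_distC; split=> //.
have := hN' N' (leqnn _); have [] := (qr'.2 j) 0 j (leq0n _) (leqnn _).
rewrite qr.1 qr'.1 subn0 => a _ b; have := word_dist_triangle A 1%g (r' j) (r N').
rewrite (word_distC A (r' j)) => c.
rewrite leqNgt; apply/negP => jN; have := leq_mul (leqnn l) (ltnW jN); lia.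
Qed.

Lemma asym_refl r : asym r r.
Proof. by exists 0 => i; exists i; rewrite word_dist0. Qed.

Lemma asym_trans r1 r2 r3 : asym r1 r2 -> asym r2 r3 -> asym r1 r3.
Proof.
move=> [H1 h1] [H2 h2]; exists (H1 + H2) => i; have [j hj] := h1 i.
have [k hk] := h2 j; exists k; have := word_dist_triangle A (r1 i) (r2 j) (r3 k); lia.
Qed.

Lemma asym_sym l r r' : qray l r -> qray l r' -> asym r r' -> asym r' r.
Proof.
move=> qr qr' a; have [H HH] := asym_close l.
by exists H; have [] := HH r r' qr qr' a.
Qed.

(** The bound on j by l d(1, q j) keeps the matching point of q in a window determined by i, where q
    already equals r'. *)
Lemma close_limit l H r r' : qray l r ->
  (forall N, exists p q, [/\ forall i, i <= N -> p i = r i,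
     forall i, i <= N -> q i = r' i &
     forall i, i <= N -> exists j, j <= l * d 1%g (q j) /\ d (p i) (q j) <= H]) ->
  close H r r'.
Proof.
move=> qr lim i; have [p [q [pr qr' pq]]] := lim (i + l * (l * i + H)).
have [j [jl hj]] := pq i (leq_addr _ _); exists j.
rewrite (pr _ (leq_addr _ _)) in hj.
have jN : j <= i + l * (l * i + H).
  apply: leq_trans jl _; apply: leq_trans (leq_addl _ _); rewrite leq_mul2l.
  apply/orP; right; have [] := (qr.2 i) 0 i (leq0n _) (leqnn _).
  rewrite qr.1 subn0; have := word_dist_triangle A 1%g (r i) (q j); lia.
by rewrite -(qr' j jN).
Qed.

Lemma asym_limit l e r r' : qray l r ->
  (forall N, exists p q n m, [/\ qray l p, qray l q,
     forall i, i <= N -> p i = r i, forall i, i <= N -> q i = r' i &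
     N <= n /\ d (p n) (q m) <= e]) ->
  asym r r'.
Proof.
have [H HH] := qray_segment_fellow_travel l => qr lim; exists H.
apply: (close_limit qr) => N.
(* The excess over N makes d(p i, p n) exceed H + e for all i <= N. *)
have [p [q [n [m [qp qq pr qr' [Nn dnm]]]]]] := lim (N + l * (H + e) + 1).
exists p, q; split => [i iN|i iN|i iN]; [apply: pr; lia|apply: qr'; lia|].
have pq0 : p 0 = q 0 by rewrite qp.1 qq.1.
have [||j _ hj] := HH n p m q e (qp.2 n) (qq.2 m) pq0 dnm i.
- by lia.
- have [_] := qp.2 n i n ltac:(lia) (leqnn _).
  rewrite ltnNge => h; apply/negP => h2; have := leq_mul (leqnn l) h2; lia.
exists j; split => //; have [_] := qq.2 j 0 j (leq0n _) (leqnn _).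
by rewrite qq.1 subn0.
Qed.

(** r' is a limit of B'-geodesics from 1 to the points r k; these fellow travel with r by a uniform
    constant. *)
Lemma asymptotic_ray_exists B B' r : ray B r -> exists r', ray B' r' /\ asym r r'.
Proof.
move=> rB.
have [l1 hl1] := geodesic_quasigeodesic A B; have [l2 hl2] := geodesic_quasigeodesic A B'.
pose l := l1 + l2; have [H HH] := qray_segment_fellow_travel l.
have qr : qray l r by split; [exact: rB.1 | move=> n; apply: hl1 (leq_addr _ _) (rB.2 n)].
pose L k := word_dist B' 1%g (r k).
have [c hc] : exists c, forall k,
    [/\ c k 0 = 1%g, c k (L k) = r k & geodesic (word_dist B') (L k) (c k)].
  by have [c hc] := choice (fun k => word_geodesic B' 1%g (r k)); exists c.
have Lgrow N : exists M, forall k, M <= k -> N <= L k.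
  have [u hu] := word_dist_lipschitz B' B.
  exists (u * N) => k hk; have := hu 1%g (r k); rewrite word_dist1 ray_length // -/(L k).
  have [//|LN] := leqP N (L k) => h.
  have [u0|u0] := posnP u; last first.
    have : u * L k < u * N by rewrite ltn_mul2l u0. lia.
  have := hu 1%g (r 1); rewrite word_dist1 ray_length // u0; lia.
clearbody L.
(* [minn i (L k)] freezes the k-th geodesic at its endpoint, so that it is indexed by all of
   [nat]. *)
have [r' hr'] : exists g : nat -> W, forall N M, exists k, M <= k /\
    forall i, i <= N -> c k (minn i (L k)) = g i.
  apply: (cluster_sequence (f := fun k i => c k (minn i (L k)))) => i.
  have [s hs] := word_ball_finite B' i; exists s => k; apply: hs.
  have [ck0 _ gk] := hc k; rewrite -word_dist1 -ck0 gk; lia.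
exists r'; split; [split|].
- by have [k [_ hk]] := hr' 0 0; rewrite -(hk 0) // min0n; have [] := hc k.
- move=> n i j ij jn; have [M hM] := Lgrow n.
  have [k [Mk hk]] := hr' n M; have Lk := hM k Mk; have [_ _ gk] := hc k.
  by rewrite -!hk ?gk; lia.
exists H; apply: (close_limit qr) => N.
have [M hM] := Lgrow N.
have [k [hk ek]] := hr' N (M + N + l * H + 1).
have [ck0 ckL gk] := hc k.
exists r, (fun i => c k (minn i (L k))); split => // i iN.
have qk : quasigeodesic d l (L k) (c k) by apply: hl2 (leq_addl _ _) gk.
have rc0 : r 0 = c k 0 by rewrite ck0 rB.1.
have rcL : d (r k) (c k (L k)) <= 0 by rewrite ckL word_dist0.
have [||j jL hj] := HH k r (L k) (c k) 0 (qr.2 k) qk rc0 rcL i.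
- by lia.
- have [_] := qr.2 k i k ltac:(lia) (leqnn _).
  rewrite ltnNge addn0 => h; apply/negP => h2; have := leq_mul (leqnn l) h2; lia.
exists j; rewrite (minn_idPl jL); split => //.
by have [_] := qk 0 j (leq0n _) jL; rewrite ck0 subn0.
Qed.

End Hyperbolic.
End WordMetric.

(** * The reflection cocycle of a Coxeter group *)

(* [N g t] tells whether the wall of the reflection [t] separates 1 from [g]. *)
Record reflection_cocycle (W : groupType) (S : genset W) (N : W -> W -> bool) := {
  cocycle_sq : forall s : W, s \in (S : seq W) -> (s * s)%g = 1%g;
  cocycleM : forall g h t : W, N (g * h)%g t = N g t (+) N h (t ^ g)%g;
  cocycleS : forall s t : W, s \in (S : seq W) -> N s t = (t == s) }.

Lemma pres_eq_relator (I : Type) (R : word I -> Prop) (r : word I) :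
  R r -> pres_eq R r [::].
Proof. by move=> Rr; have := pres_rel [::] [::] Rr; rewrite /= cats0. Qed.

Section CoxeterCocycle.
Variables (W : groupType) (n : nat) (s : 'I_n -> W) (m : 'I_n -> 'I_n -> option nat).
Hypothesis (mP : coxeter_matrix m) (presW : presented_by s (coxeter_relators m)).

(** Parity of the number of times the path of u from 1 crosses the wall of t. Since it is invariant
    under the relators, it descends to W. *)
Fixpoint word_cocycle (u : word 'I_n) (t : W) : bool :=
  if u is x :: u' then (t == s x.1) (+) word_cocycle u' (t ^ s x.1)%g else false.

Lemma generator_sq i : (s i * s i)%g = 1%g.
Proof.
have [_ H] := presW; have /H : pres_eq (coxeter_relators m) [:: (i, true); (i, true)] [::].
  apply: pres_eq_relator.
  by exists i, i, 1; split => //; case: mP => _ _ H1; apply/H1.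
by rewrite /word_eval !big_cons !big_nil mulg1.
Qed.

Lemma generatorV i : ((s i)^-1)%g = s i.
Proof. by apply: mulg1_eq; exact: generator_sq. Qed.

Lemma word_eval_cons x u : word_eval s (x :: u) = (s x.1 * word_eval s u)%g.
Proof. by rewrite /word_eval big_cons; case: x => i [] //=; rewrite generatorV. Qed.

Lemma word_cocycle_cat u v t :
  word_cocycle (u ++ v) t = word_cocycle u t (+) word_cocycle v (t ^ word_eval s u)%g.
Proof.
elim: u t => [|x u IH] t /=; first by rewrite /word_eval big_nil conjg1.
by rewrite IH word_eval_cons conjgM addbA.
Qed.

(* The relator (ab)^k has reflections (ab)^q a for q < 2k, and these have
   period k because (ab)^k = 1. *)
Lemma word_cocycle_relator r t : coxeter_relators m r -> word_cocycle r t = false.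
Proof.
move=> rR; have r1 : word_eval s r = 1%g.
  have [_ H] := presW; have /H -> : pres_eq (coxeter_relators m) r [::].
    exact: pres_eq_relator.
  by rewrite /word_eval big_nil.
case: rR => i [j [k [_ er]]]; move: r1; rewrite {}er.
set x := (s i * s j)%g.
have cat2 p : flatten (nseq p.+1 [:: (i, true); (j, true)]) =
    [:: (i, true), (j, true) & flatten (nseq p [:: (i, true); (j, true)])] by [].
have ev p : word_eval s (flatten (nseq p [:: (i, true); (j, true)])) = (x ^+ p)%g.
  elim: p => [|p IH]; first by rewrite /word_eval big_nil.
  by rewrite cat2 !word_eval_cons IH mulgA expgS.
have siV : (s i * x^-1)%g = (x * s i)%g.
  by rewrite /x invgM !generatorV mulgA.
have ref p : word_cocycle (flatten (nseq p [:: (i, true); (j, true)])) t =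
    \big[addb/false]_(0 <= q < p.*2) (t == x ^+ q * s i)%g.
  elim: p t => [|p IH] t'; first by rewrite big_nil.
  rewrite cat2 doubleS big_nat_recl // big_nat_recl // /= IH -conjgM -/x.
  rewrite mul1g expg1; congr (_ (+) (_ (+) _)).
    rewrite (can2_eq (conjgK _) (conjgKV _)) conjgE invgK generatorV /x.
    by rewrite mulgA.
  apply: eq_bigr => q _; rewrite (can2_eq (conjgK _) (conjgKV _)) conjgE invgK.
  by rewrite -(mulgA _ (s i)) siV expgS expgSr !mulgA.
rewrite ev => xk1; rewrite ref -addnn (big_cat_nat (leq0n k)) ?leq_addr //=.
rewrite -{2}[k]add0n big_addn addnK.
under [X in _ (+) X]eq_bigr => q _ do rewrite expgnDr xk1 mulg1.
by rewrite addbb.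
Qed.

Lemma word_cocycle_pres u v : pres_eq (coxeter_relators m) u v ->
  word_cocycle u =1 word_cocycle v.
Proof.
elim=> {u v} [||u v w _ IH1 _ IH2|u v i b|u v r rR] //.
- by move=> u v _ IH t; rewrite IH.
- by move=> t; rewrite IH1 IH2.
- move=> t; rewrite !word_cocycle_cat /=; congr (_ (+) _).
  set t' := (t ^ _)%g; rewrite -conjgM generator_sq conjg1 addbA.
  by rewrite (can2_eq (conjgK _) (conjgKV _)) conjgE invgK mulgV mulg1 addbb.
move=> t; rewrite !word_cocycle_cat (word_cocycle_relator _ rR) /=; congr (_ (+) _).
suff -> : word_eval s r = 1%g by rewrite conjg1.
have [_ H] := presW; have /H -> : pres_eq (coxeter_relators m) r [::].
  exact: pres_eq_relator.
by rewrite /word_eval big_nil.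
Qed.

Lemma reflection_cocycle_presented :
  exists (S : genset W) N, reflection_cocycle S N.
Proof.
have gen g : exists w, word_over (codom s) w /\ (\prod_(x <- w) x)%g = g.
  have [[u <-] _] := (presW.1 g, 0); elim: u => [|x u [w [wS ew]]].
    by exists [::]; rewrite /word_eval !big_nil.
  exists (s x.1 :: w); rewrite big_cons word_eval_cons ew /= wS codom_f.
  by split.
have [u hu] := choice presW.1.
exists (Genset gen), (fun g => word_cocycle (u g)); split => /=.
- by move=> _ /codomP[i ->]; exact: generator_sq.
- move=> g h t; rewrite -[X in (t ^ X)%g]hu -word_cocycle_cat; apply: word_cocycle_pres.
  apply/(presW.2); rewrite /word_eval big_cat /=.
  by rewrite -!/(word_eval _ _) !hu.
- move=> _ t /codomP[i ->].
  rewrite (word_cocycle_pres (v := [:: (i, true)])) /= ?addbF //.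
  by apply/(presW.2); rewrite hu word_eval_cons /word_eval big_nil mulg1.
Qed.

End CoxeterCocycle.

Lemma coxeter_reflection_cocycle (W : groupType) :
  coxeter_group W -> exists (S : genset W) N, reflection_cocycle S N.
Proof. by move=> [n [s [m [mP presW]]]]; exact: reflection_cocycle_presented mP presW. Qed.

(** * Parabolic subgroups and descents *)

Definition prodg (W : groupType) (p : seq W) : W := (\prod_(x <- p) x)%g.

Section Prodg.
Variable W : groupType.
Implicit Types (x : W) (p q : seq W).

Lemma prodg_nil : prodg (Nil W) = 1%g. Proof. exact: big_nil. Qed.

Lemma prodg_cons x p : prodg (x :: p) = (x * prodg p)%g. Proof. exact: big_cons. Qed.

Lemma prodg1 x : prodg [:: x] = x. Proof. exact: big_seq1. Qed.

Lemma prodg_cat p q : prodg (p ++ q) = (prodg p * prodg q)%g. Proof. exact: big_cat. Qed.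

End Prodg.

Section Coxeter.
Variables (W : groupType) (S : genset W) (N : W -> W -> bool).
Hypothesis NP : reflection_cocycle S N.

Let S2 := cocycle_sq NP.
Let NM := cocycleM NP.
Let NS := cocycleS NP.
Local Notation ell := (word_length S).
Implicit Types (g h j s t u v w x y : W) (J : pred W).

Lemma coxeter_invS s : s \in (S : seq W) -> (s^-1)%g = s.
Proof. by move=> sS; apply: mulg1_eq; exact: S2. Qed.

Lemma cocycle1 t : N 1%g t = false.
Proof. by have := NM 1%g 1%g t; rewrite mulg1 conjg1 addbb. Qed.

Lemma word_over_gens (p : seq W) : word_over S p = all [in (S : seq W)] p.
Proof.
apply: eq_all => x /=; case: (boolP (x \in _)) => //= xS.
by apply/negP => /[dup] h; rewrite -(coxeter_invS h) invgK; apply/negP.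
Qed.

(* The walls crossed by the path p = s_1 ... s_n from the identity: the elements
   (s_1 ... s_(i-1)) s_i (s_1 ... s_(i-1))^-1. *)
Fixpoint reflections (p : seq W) : seq W :=
  if p is s :: p' then s :: [seq (t ^ s^-1)%g | t <- reflections p'] else [::].

Lemma size_reflections p : size (reflections p) = size p.
Proof. by elim: p => //= s p IH; rewrite size_map IH. Qed.

Lemma cocycle_prod p t : all [in (S : seq W)] p ->
  N (prodg p) t = odd (count_mem t (reflections p)).
Proof.
elim: p t => [|s p IH] t /=; first by rewrite prodg_nil cocycle1.
case/andP => sS pS; rewrite prodg_cons NM (NS _ sS) IH // oddD eq_sym.
rewrite count_map; congr (_ (+) odd _); first by case: eqP.
by apply: eq_count => x /=; rewrite (can2_eq (conjgKV _) (conjgK _)).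
Qed.

Definition gen_subset J := forall s, J s -> s \in (S : seq W).

Lemma gen_subset_all J p : gen_subset J -> all J p -> all [in (S : seq W)] p.
Proof. by move=> JS; apply: sub_all. Qed.

(** Left multiplication by t reflects the initial part of the path and cancels the letter that
    crosses the wall of t. *)
Lemma exchange J p t : gen_subset J -> all J p -> t \in reflections p ->
  exists p', [/\ all J p', size p = (size p').+1 & prodg p' = (t * prodg p)%g].
Proof.
move=> JS; elim: p t => [|s p IH] t //= /andP[sJ pJ].
rewrite inE => /orP[/eqP->|].
  by exists p; split => //; rewrite prodg_cons mulgA S2 ?mul1g //; apply: JS.
case/mapP => t' /(IH _ pJ)[p' [p'J sp ep]] ->.
exists (s :: p'); split => /=; rewrite ?sJ ?sp //.
by rewrite !prodg_cons ep conjgE invgK !mulgA mulgVK.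
Qed.

(** When a wall is crossed twice, [exchange] at the second crossing absorbs the letter of the
    first. *)
Lemma deletion J p : gen_subset J -> all J p -> ~~ uniq (reflections p) ->
  exists p', [/\ all J p', size p' < size p & prodg p' = prodg p].
Proof.
move=> JS; elim: p => [|s p IH] //= /andP[sJ pJ].
rewrite negb_and negbK (map_inj_uniq (can_inj (conjgKV s))).
case: (boolP (uniq _)) => /= [_|/(IH pJ)[p' [p'J sp ep]] _]; last first.
  by exists (s :: p'); rewrite /= sJ !prodg_cons ep.
rewrite orbF => /mapP[t tp es].
have et : t = s.
  by move: es => /(congr1 (conjg^~ s)); rewrite conjgKV conjgE mulKg.
move: tp; rewrite et => /(exchange JS pJ)[p' [p'J sp ep]].
by exists p'; rewrite prodg_cons ep sp; split => //; lia.
Qed.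

Lemma reduced_word J p : gen_subset J -> all J p ->
  exists p', [/\ all J p', prodg p' = prodg p & uniq (reflections p')].
Proof.
move=> JS; have [n] := ubnP (size p); elim: n p => // n IH p sp pJ.
case: (boolP (uniq (reflections p))) => [|/(deletion JS pJ)[p' [p'J sp' ep]]].
  by exists p.
by have [|p2 [? e ?]] := IH p' _ p'J; [lia | exists p2; rewrite e].
Qed.

(** A wall crossed exactly once has odd parity, which depends on the element only; so every word for
    it crosses all these walls. *)
Lemma reduced_length p : all [in (S : seq W)] p -> uniq (reflections p) ->
  ell (prodg p) = size p.
Proof.
move=> pS up; apply/eqP; rewrite eqn_leq; apply/andP; split.
  by apply: word_length_min => //; rewrite word_over_gens.
have [q [<- qS eq]] := word_lengthP S (prodg p).
rewrite -(size_reflections p) -(size_reflections q); apply: uniq_leq_size => // t tp.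
rewrite word_over_gens in qS; have := cocycle_prod t pS.
by rewrite count_uniq_mem // tp -eq (cocycle_prod t qS) -has_pred1 has_count; case: count.
Qed.

Definition parabolic J g := exists p, all J p /\ prodg p = g.

Lemma parabolic_word J g : gen_subset J -> parabolic J g ->
  exists p, [/\ all J p, prodg p = g, size p = ell g & uniq (reflections p)].
Proof.
move=> JS [p [pJ <-]]; have [q [qJ eq uq]] := reduced_word JS pJ.
by exists q; split=> //; rewrite -eq reduced_length //; apply: gen_subset_all qJ.
Qed.

Lemma parabolicS g : parabolic [in (S : seq W)] g.
Proof. by have [p [pS pg]] := gensP S g; exists p; rewrite -word_over_gens. Qed.

Lemma parabolic1 J : parabolic J 1%g.
Proof. by exists [::]; rewrite prodg_nil. Qed.

Lemma parabolic_gen (J : pred W) s : J s -> parabolic J s.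
Proof. by exists [:: s]; rewrite prodg1 /= andbT. Qed.

Lemma parabolicM J g h : parabolic J g -> parabolic J h -> parabolic J (g * h)%g.
Proof. by move=> [p [pJ <-]] [q [qJ <-]]; exists (p ++ q); rewrite all_cat pJ prodg_cat. Qed.

Lemma parabolicV J g : gen_subset J -> parabolic J g -> parabolic J g^-1%g.
Proof.
move=> JS [p [pJ <-]]; exists (rev p); rewrite all_rev; split => //.
rewrite -[in RHS](revK p) /prodg -prodgV.
by apply: eq_big_seq => x; rewrite mem_rev => /(allP pJ)/JS/coxeter_invS.
Qed.

Lemma cocycle_length g t : N g t -> ell (t * g)%g < ell g.
Proof.
have [p [pS <- sp up]] := parabolic_word (fun=> id) (parabolicS g).
rewrite cocycle_prod // => Np.
have tp : t \in reflections p by rewrite -has_pred1 has_count; case: count Np.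
have [p' [p'S s' <-]] := exchange (fun=> id) pS tp.
rewrite -sp s' ltnS; apply: word_length_min => //; by rewrite word_over_gens.
Qed.

Lemma reflection_parabolic J p t : gen_subset J -> all J p -> t \in reflections p ->
  exists x j, [/\ parabolic J x, J j & t = (j ^ x^-1)%g].
Proof.
move=> JS; elim: p t => [|s p IH] t //= /andP[sJ pJ]; rewrite inE => /orP[/eqP->|].
  by exists 1%g, s; split => //; [exact: parabolic1 | rewrite invg1 conjg1].
case/mapP => t' /(IH _ pJ)[x [j [xJ jJ ->]]] ->; exists (s * x)%g, j.
by rewrite invgM conjgM; split => //; apply: parabolicM => //; apply: parabolic_gen.
Qed.

Lemma cocycle_parabolic J g t : gen_subset J -> parabolic J g -> N g t ->
  exists x j, [/\ parabolic J x, J j & t = (j ^ x^-1)%g].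
Proof.
move=> JS [p [pJ <-]]; rewrite cocycle_prod ?(gen_subset_all JS) // => Np.
by apply: (reflection_parabolic JS pJ); rewrite -has_pred1 has_count; case: count Np.
Qed.

Lemma parabolic_reflection J x j : gen_subset J -> parabolic J x -> J j ->
  parabolic J (j ^ x^-1)%g.
Proof.
move=> JS xJ jJ; rewrite conjgE invgK; apply: parabolicM => //.
by apply: parabolicM; [apply: parabolic_gen | apply: parabolicV].
Qed.

Lemma length_gen s : s \in (S : seq W) -> ell s = 1.
Proof.
by move=> sS; have := @reduced_length [:: s]; rewrite prodg1 /= andbT => ->.
Qed.

Lemma length_descent g s : s \in (S : seq W) -> N g s -> ell g = (ell (s * g)%g).+1.
Proof.
move=> sS /cocycle_length h; have := word_lengthM S s (s * g)%g.
by rewrite mulgA S2 // mul1g (length_gen sS); lia.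
Qed.

Lemma length_ascent g s : s \in (S : seq W) -> ~~ N g s -> ell (s * g)%g = (ell g).+1.
Proof.
move=> sS ngs; rewrite (@length_descent (s * g)%g s) // ?mulgA ?S2 ?mul1g //.
by rewrite NM NS // eqxx conjgE mulKg.
Qed.

Lemma descent_length g s : s \in (S : seq W) -> N g s = (ell (s * g)%g < ell g).
Proof.
move=> sS; case: (boolP (N g s)) => [/(length_descent sS)|/(length_ascent sS)] ->.
  by rewrite ltnS leqnn.
by rewrite ltnNge leqnSn.
Qed.

Lemma first_descent J g : gen_subset J -> parabolic J g -> g <> 1%g ->
  exists j, J j /\ N g j.
Proof.
move=> JS gJ g1; have [[|j p] [pJ eg sp _]] := parabolic_word JS gJ.
  by case: g1; rewrite -eg prodg_nil.
move: pJ => /= /andP[jJ pJ]; exists j; split => //.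
rewrite descent_length ?(JS _ jJ) // -sp -eg prodg_cons mulgA S2 ?(JS _ jJ) // mul1g ltnS.
by apply: word_length_min => //; rewrite word_over_gens (gen_subset_all JS).
Qed.

Lemma gen_parabolic J s : gen_subset J -> s \in (S : seq W) -> parabolic J s -> J s.
Proof.
move=> JS sS sJ; have [[|j [|k p]] [pJ es sp _]] := parabolic_word JS sJ.
- by move: sp; rewrite length_gen.
- by move: es pJ; rewrite prodg1 /= andbT => ->.
- by move: sp; rewrite length_gen.
Qed.

Lemma reduced_cons J j p : gen_subset J -> all J (j :: p) -> size (j :: p) = ell (prodg (j :: p)) ->
  size p = ell (prodg p) /\ ~~ N (prodg p) j.
Proof.
move=> JS /= /andP[jJ pJ]; rewrite prodg_cons => e.
have := word_lengthM S j (prodg p); rewrite (length_gen (JS _ jJ)).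
have := @word_length_min _ S (prodg p) p; rewrite word_over_gens (gen_subset_all JS) // => /(_ isT erefl).
by move=> h1 h2; split; [lia | rewrite descent_length ?(JS _ jJ) //; lia].
Qed.

Lemma coset_minimum J w : gen_subset J -> exists u v,
  [/\ parabolic J u, w = (u * v)%g & forall y, parabolic J y -> ell v <= ell (y * v)%g].
Proof.
move=> JS; pose P n := `[< exists x, parabolic J x /\ ell (x * w)%g = n >].
have exP : exists n, P n.
  by exists (ell w); apply/asboolP; exists 1%g; rewrite mul1g; split => //; exact: parabolic1.
have [n /asboolP[x [xJ en]] minn] := ex_minnP exP.
exists (x^-1)%g, (x * w)%g; split; [exact: parabolicV | by rewrite mulKg|].
move=> y yJ; rewrite en mulgA; apply: minn; apply/asboolP.
by exists (y * x)%g; split => //; apply: parabolicM.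
Qed.

(* A minimal element of the coset W_J v0 has no reflection of W_J in its
   inversion set, so left multiplication by W_J is length-additive on it. *)
Lemma coset_length J v u : gen_subset J -> (forall j, J j -> ~~ N v j) ->
  parabolic J u -> ell (u * v)%g = ell u + ell v.
Proof.
move=> JS vJ.
have [x [v0 [xJ ev min0]]] := coset_minimum v JS.
have add0 y : parabolic J y -> ell (y * v0)%g = ell y + ell v0.
  move=> yJ; have [p [pJ <- sp _]] := parabolic_word JS yJ.
  elim: p pJ sp {y yJ} => [|j p IH] pJ sp.
    by rewrite prodg_nil mul1g word_length1.
  have [sp' nj] := reduced_cons JS pJ sp.
  move: pJ => /= /andP[jJ pJ]; rewrite -sp prodg_cons -mulgA length_ascent ?(JS _ jJ) //.
    by rewrite IH // -sp'.
  rewrite NM (negbTE nj) /=; apply/negP => /cocycle_length; apply/negP; rewrite -leqNgt.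
  apply: min0; have pp : parabolic J (prodg p) by exists p.
  rewrite -[X in (_ ^ X)%g]invgK; apply: parabolic_reflection => //.
  exact: parabolicV.
have [x1|/eqP x1] := eqVneq x 1%g; first by move=> uJ; rewrite ev x1 mul1g add0.
(* With v = x v0 and lengths adding, a first letter j of x would be a descent of v in J. *)
have [j [jJ Nj]] := first_descent JS xJ x1.
exfalso; move/negP: (vJ j jJ); apply.
have jxJ := parabolicM (parabolic_gen jJ) xJ.
rewrite descent_length ?(JS _ jJ) // ev mulgA (add0 _ xJ) (add0 _ jxJ) ltn_add2r.
by rewrite -descent_length ?(JS _ jJ).
Qed.

(** Elements of W_J are initial segments of geodesics to w, so their lengths are bounded by that of
    w and W_J is finite. In the induction w = y z and j is a descent of w but not of y, so the wall
    of j is crossed within z. *)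
Lemma spherical_descents J w x : gen_subset J -> (forall j, J j -> N w j) ->
  parabolic J x -> ell x + ell (x^-1 * w)%g = ell w.
Proof.
move=> JS wJ xJ; have [p [pJ <- sp _]] := parabolic_word JS xJ.
elim: p pJ sp {x xJ} => [|j p IH] pJ sp.
  by rewrite prodg_nil word_length1 invg1 mul1g.
have [sp' nj] := reduced_cons JS pJ sp.
move: pJ => /= /andP[jJ pJ]; have {}IH := IH pJ sp'.
set y := prodg p in nj sp' IH *; set z := (y^-1 * w)%g in IH *.
have wz : w = (y * z)%g by rewrite mulVKg.
have := wJ j jJ; rewrite wz NM (negbTE nj) /= => /cocycle_length h.
have -> : ((prodg (j :: p))^-1 * (y * z) = (j ^ y) * z)%g.
  by rewrite prodg_cons invgM (coxeter_invS (JS _ jJ)) conjgE !mulgA.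
have := word_lengthM S (prodg (j :: p)) ((j ^ y) * z)%g.
have -> : (prodg (j :: p) * ((j ^ y) * z) = y * z)%g.
  by rewrite prodg_cons conjgE -/y -!mulgA mulVKg (mulgA j j) S2 ?mul1g // (JS _ jJ).
have h' : ell ((j ^ y) * z)%g < ell z := h.
rewrite -wz; move: IH h' sp sp' => /=; clearbody z y; lia.
Qed.

End Coxeter.

(** * Connectedness of cones *)

Definition finite_order (W : groupType) (x : W) := exists n, 0 < n /\ (x ^+ n)%g = 1%g.

Section Cone.
Variables (W : groupType) (S : genset W) (N : W -> W -> bool).
Hypothesis NP : reflection_cocycle S N.

Local Notation ell := (word_length S).
Implicit Types (g h j s t u v w x y z : W) (J : pred W) (P : W -> Prop).

(** The inverse appears because [N] detects descents under left multiplication, while Cayley edges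
    multiply on the right. *)
Definition ascent g s := s \in (S : seq W) /\ ~~ N (g^-1)%g s.

Lemma ascent_length g s : ascent g s -> ell (g * s)%g = (ell g).+1.
Proof.
move=> [sS ngs]; have := length_ascent NP sS ngs.
by rewrite word_lengthVE => <-; rewrite -word_lengthVE invgM (coxeter_invS NP sS).
Qed.

Lemma not_ascent_length g s : s \in (S : seq W) -> ~ ascent g s ->
  ell g = (ell (g * s)%g).+1.
Proof.
move=> sS ngs; have gs : N (g^-1)%g s by apply/negPn/negP => h; apply: ngs.
have := length_descent NP sS gs; rewrite word_lengthVE => ->.
by rewrite -[in LHS]word_lengthVE invgM invgK (coxeter_invS NP sS).
Qed.

Lemma ascentE g s : s \in (S : seq W) -> ascent g s \/ ell g = (ell (g * s)%g).+1.
Proof.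
by move=> sS; have [|/(not_ascent_length sS)] := pselect (ascent g s); [left | right].
Qed.

Lemma odd_length g s : s \in (S : seq W) -> odd (ell (g * s)%g) = ~~ odd (ell g).
Proof. by move=> sS; have [/ascent_length->//|->] := ascentE g sS; rewrite /= negbK. Qed.

(* Some geodesic from 1 to h passes through g. *)
Definition cone g h := ell h = ell g + ell (g^-1 * h)%g.

Lemma cone_refl g : cone g g.
Proof. by rewrite /cone mulVg word_length1 addn0. Qed.

Lemma cone_trans g h k : cone g h -> cone h k -> cone g k.
Proof.
have e1 : (g * (g^-1 * k))%g = k by rewrite mulVKg.
have e2 : (g^-1 * h * (h^-1 * k))%g = (g^-1 * k)%g by rewrite -mulgA mulVKg.
rewrite /cone => gh hk; have := word_lengthM S (g^-1 * h)%g (h^-1 * k)%g.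
have := word_lengthM S g (g^-1 * k)%g.
by rewrite e1 e2; lia.
Qed.

Lemma coset_cone J z u : gen_subset S J -> (forall j, J j -> ~~ N (z^-1)%g j) ->
  parabolic J u -> cone z (z * u)%g.
Proof.
move=> JS zJ uJ; have := coset_length NP JS zJ (parabolicV NP JS uJ).
by rewrite -invgM !word_lengthVE /cone mulKg addnC.
Qed.

Inductive walk P x : W -> Prop :=
| walk_nil : P x -> walk P x x
| walk_step y s : walk P x y -> s \in (S : seq W) -> P (y * s)%g -> walk P x (y * s)%g.

Lemma walk_end P x y : walk P x y -> P y.
Proof. by case. Qed.

Lemma walk_trans P x y z : walk P x y -> walk P y z -> walk P x z.
Proof. by move=> xy yz; elim: yz => // z' s _ IH sS Pz; apply: walk_step. Qed.

Lemma walk_sym P x y : walk P x y -> walk P y x.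
Proof.
elim=> [|y' s xy IH sS Py]; first exact: walk_nil.
apply: walk_trans IH; have Py' := walk_end xy.
have := walk_step (walk_nil Py) sS; rewrite -mulgA (cocycle_sq NP) // mulg1; exact.
Qed.

Lemma walk_sub P (Q : W -> Prop) x y : (forall h, P h -> Q h) -> walk P x y -> walk Q x y.
Proof.
move=> PQ; elim=> [/PQ|y' s _ IH sS /PQ]; first exact: walk_nil.
exact: walk_step.
Qed.

(* Go around the finite dihedral coset z W_{s,t}, of which z is the lowest element. *)
Lemma dihedral_walk z s t : ascent z s -> ascent z t -> finite_order (s * t)%g ->
  walk (fun h => cone z h /\ ell z < ell h) (z * s)%g (z * t)%g.
Proof.
move=> [sS ns] [tS nt] [n0 [n0_gt0 xn0]].
set x := (s * t)%g in xn0 *; pose J : pred W := pred2 s t.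
have JS : gen_subset S J by move=> j /orP[] /eqP->.
have exo : exists n, (0 < n) && ((x ^+ n)%g == 1%g).
  by exists n0; rewrite n0_gt0 xn0 eqxx.
have [m /andP[m_gt0 /eqP xm] minm] := ex_minnP exo.
have zJ j : J j -> ~~ N (z^-1)%g j by case/orP=> /eqP->.
have Js : parabolic J s by apply: parabolic_gen; rewrite /J /= eqxx.
have Jt : parabolic J t by apply: parabolic_gen; rewrite /J /= eqxx orbT.
have Jx i : parabolic J (x ^+ i)%g.
  elim: i => [|i IH]; first exact: parabolic1.
  by rewrite expgS; apply: parabolicM IH; apply: parabolicM.
have above u : parabolic J u -> u <> 1%g ->
    cone z (z * u)%g /\ ell z < ell (z * u)%g.
  move=> uJ u1; have zu := coset_cone JS zJ uJ; split => //.
  rewrite zu mulKg -[X in X < _]addn0 ltn_add2l lt0n; apply/eqP.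
  by move/(word_length_eq0 (A := S)).
(* Parity of length shows that the walk misses z at the elements x^i s; at the powers x^i this is
   minimality of m. *)
have evenx i : odd (ell (x ^+ i)%g) = false.
  elim: i => [|i IH]; first by rewrite word_length1.
  by rewrite expgSr /x mulgA !odd_length // negbK.
have xs1 i : (x ^+ i * s)%g <> 1%g.
  by move/(congr1 (fun w => odd (ell w))); rewrite odd_length // evenx word_length1.
have main i : i < m -> walk (fun h => cone z h /\ ell z < ell h)
    (z * s)%g (z * (x ^+ i * s))%g.
  elim: i => [|i IH] im.
    by rewrite mul1g; apply: walk_nil; apply: above => // s1; apply: (xs1 0); rewrite mul1g.
  have xi1 : (x ^+ i.+1)%g <> 1%g.
    by move=> e; have := minm i.+1; rewrite e eqxx => /(_ isT); lia.
  have w1 : walk (fun h => cone z h /\ ell z < ell h) (z * s)%g (z * (x ^+ i.+1))%g.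
    have := walk_step (IH (ltnW im)) tS; rewrite -!mulgA -/x -expgSr; apply.
    exact: above.
  have := walk_step w1 sS; rewrite -!mulgA; apply.
  by apply: above => //; apply: parabolicM.
have := main m.-1; rewrite prednK // => /(_ (leqnn _)).
suff -> : (x ^+ m.-1 * s)%g = t by [].
rewrite -(coxeter_invS NP tS); apply: (mulIg t); rewrite mulVg -mulgA -/x -expgSr.
by rewrite prednK.
Qed.

(* Impredicative form of: the ascents s and t at g are joined by a chain of
   ascents in which the product of consecutive elements has finite order. *)
Definition linked g s t := forall P : W -> Prop, P s ->
  (forall a b, ascent g a -> ascent g b -> finite_order (a * b)%g -> P a -> P b) -> P t.

Hypothesis link : forall g s t, ascent g s -> ascent g t -> linked g s t.

Let level g k h := cone g h /\ k <= ell h.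

Lemma ascent_walk g z s t : cone g z -> ascent z s -> ascent z t ->
  walk (level g (ell z).+1) (z * s)%g (z * t)%g.
Proof.
move=> gz zs zt.
apply: (link zs zt (P := fun a => walk (level g (ell z).+1) (z * s)%g (z * a)%g)).
  apply: walk_nil; split; last by rewrite ascent_length.
  apply: cone_trans gz _; rewrite /cone mulKg (ascent_length zs).
  by rewrite (length_gen NP zs.1) addn1.
move=> a b za zb ab wa; apply: walk_trans wa _.
apply: walk_sub (dihedral_walk za zb ab) => h [zh hh]; split => //.
exact: cone_trans zh.
Qed.

(* At each visit of the lowest level the walk comes down one ascent and leaves by
   another one; reroute it between the two through [ascent_walk]. *)
Lemma push_walk g k x y : walk (level g k) x y -> k < ell x ->
  (k < ell y -> walk (level g k.+1) x y) /\
  (forall s, k = ell y -> ascent y s -> walk (level g k.+1) x (y * s)%g).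
Proof.
elim=> [[gx _] kx|y' s xy IH sS [gys kys] kx].
  by split => [_|s kx']; [exact: walk_nil | lia].
have {}[IH1 IH2] := IH kx; have [gy ky] := walk_end xy.
have ss : (y' * s * s)%g = y' by rewrite -mulgA (cocycle_sq NP) // mulg1.
have [asc|down] := ascentE y' sS.
  have e := ascent_length asc; split => [_|s' ks' _]; last by lia.
  have [ky'|ky'] := ltnP k (ell y'); last by apply: IH2 => //; lia.
  by apply: walk_step => //; [exact: IH1 | split=> //; lia].
split => [kys'|s' ks' asc'].
  by apply: walk_step => //; apply: IH1; lia.
have asc : ascent (y' * s)%g s.
  by have [//|] := ascentE (y' * s)%g sS; rewrite ss; lia.
have := ascent_walk gys asc asc'; rewrite -ks' ss => w.
by apply: walk_trans w; apply: IH1; lia.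
Qed.

Lemma cone_walk g x : cone g x -> walk (level g (ell g)) g x.
Proof.
move=> gx; have [p [pS ep sp _]] := parabolic_word NP (fun=> id) (parabolicS NP (g^-1 * x)%g).
have -> : x = (g * prodg p)%g by rewrite ep mulVKg.
have : ell (g * prodg p)%g = ell g + size p by rewrite ep mulVKg sp -gx.
elim/last_ind: p pS {x gx ep sp} => [|p s IH] pS e.
  by rewrite prodg_nil mulg1; apply: walk_nil; split; [exact: cone_refl | ].
move: pS; rewrite all_rcons => /andP[sS pS].
have ep : prodg (rcons p s) = (prodg p * s)%g by rewrite -cats1 prodg_cat prodg1.
have ea : (g * (prodg p * s))%g = (g * prodg p * s)%g by rewrite mulgA.
have eK : (g^-1 * (g * prodg p * s))%g = (prodg p * s)%g by rewrite -mulgA mulKg.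
move: e; rewrite ep ea size_rcons => e.
have e1 := word_lengthM S (g * prodg p)%g s; rewrite (length_gen NP sS) in e1.
have e2 := word_lengthM S g (prodg p).
have pS' : word_over S p by rewrite (word_over_gens NP).
have e3 := word_length_min pS' (erefl (prodg p)).
apply: walk_step => //; first by apply: IH => //; lia.
have e4 := word_lengthM S (prodg p) s; rewrite (length_gen NP sS) in e4.
have e5 := word_lengthM S g (prodg p * s)%g; rewrite ea in e5.
by split; rewrite /cone ?eK; lia.
Qed.

(** Start with geodesics from x and y down to g, then raise the walk one level at a time by
    [push_walk]. *)
Lemma cone_level_connected g k x y : ell g <= k -> cone g x -> cone g y ->
  k <= ell x -> k <= ell y -> walk (level g k) x y.
Proof.
elim: k x y => [|k IH] x y gk gx gy kx ky; move: gk; rewrite leq_eqVlt => /orP[/eqP e|gk].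
- by rewrite -e; apply: walk_trans (cone_walk gy); apply: walk_sym; apply: cone_walk.
- by [].
- by rewrite -e; apply: walk_trans (cone_walk gy); apply: walk_sym; apply: cone_walk.
have := push_walk (IH x y gk gx gy (ltnW kx) (ltnW ky)) kx.
by move=> [/(_ ky)].
Qed.

End Cone.

(** * One end *)

Section InfiniteOrder.
Variable W : groupType.
Implicit Types (x y z : W).

Lemma finite_order_eq x m n : m < n -> (x ^+ m)%g = (x ^+ n)%g -> finite_order x.
Proof.
move=> mn e; exists (n - m); rewrite subn_gt0; split => //.
by rewrite expgnFr ?(ltnW mn) // e mulgV.
Qed.

Lemma finite_orderC x y : finite_order (x * y)%g -> finite_order (y * x)%g.
Proof.
move=> [n [n0 e]]; exists n; split => //.
have -> : (y * x = (x * y) ^ x)%g by rewrite conjgE !mulgA mulVg mul1g.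
by rewrite -conjXg e conj1g.
Qed.

Lemma infinite_order_avoids x (K : seq W) : ~ finite_order x ->
  exists n, forall m, n <= m -> (x ^+ m)%g \notin K.
Proof.
move=> nx; elim: K => [|k K [n IH]]; first by exists 0.
have [[q eq]|no] := pselect (exists q, (x ^+ q)%g = k).
  exists (maxn n q.+1) => m hm; rewrite inE negb_or IH ?andbT; last by lia.
  by apply/eqP => e; apply: nx; apply: (@finite_order_eq x q m); [lia | rewrite eq].
by exists n => m hm; rewrite inE negb_or IH ?andbT //; apply/eqP => e; apply: no; exists m.
Qed.

Lemma bounded_finite_order (A : genset W) k x :
  (forall n, word_length A (x ^+ n)%g <= k) -> finite_order x.
Proof.
move=> bx; apply: contrapT => nx; have [K hK] := word_ball_finite A k.
by have [n /(_ n (leqnn n))/negP[]] := infinite_order_avoids K nx; apply: hK.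
Qed.

(** Concatenate the translates by powers of x of a geodesic from 1 to x. *)
Lemma infinite_order_ray (A : genset W) x : ~ finite_order x ->
  exists r L, [/\ proper_ray A r, 0 < L & forall n, r (n * L) = (x ^+ n)%g].
Proof.
move=> nx; have [c [c0 cL gc]] := word_geodesic A 1%g x.
set L := word_dist A 1%g x in cL gc.
have L0 : 0 < L.
  rewrite lt0n; apply/eqP; rewrite /L word_dist1 => /word_length_eq0 x1.
  by apply: nx; exists 1; rewrite x1.
pose r n := (x ^+ (n %/ L) * c (n %% L))%g.
exists r, L; split => //; last by move=> n; rewrite /r mulnK // modnMl c0 mulg1.
split=> [n|K].
  rewrite /cayley_adj; apply/eqP.
  have -> : r n.+1 = (x ^+ (n %/ L) * c (n %% L).+1)%g.
    have e : n.+1 = n %/ L * L + (n %% L).+1 by rewrite addnS -divn_eq.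
    rewrite /r {1 2}e divnMDl // modnMDl.
    have [lt|ge] := ltnP (n %% L).+1 L; first by rewrite (divn_small lt) addn0 (modn_small lt).
    have -> : (n %% L).+1 = L by apply/eqP; rewrite eqn_leq ge ltn_pmod.
    by rewrite divnn L0 addn1 modnn c0 cL mulg1 expgSr.
  by rewrite word_distMl (gc (n %% L)) ?subSnn //; rewrite ltn_pmod.
(* If x^q c_i is in K, then x^q is in the finite set of all k c_i^-1, which high powers avoid. *)
have [M hM] := infinite_order_avoids [seq (k * (c i)^-1)%g | k <- K, i <- iota 0 L] nx.
exists (M * L) => n hn; apply/negP => rK.
have /negP[] := hM (n %/ L) (ltac:(by rewrite leq_divRL)).
apply/allpairsP; exists (r n, n %% L); split => //=; first by rewrite mem_iota ltn_pmod.
by rewrite mulgK.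
Qed.

End InfiniteOrder.

Section OneEnd.
Variables (W : groupType) (S A : genset W) (N : W -> W -> bool).
Hypothesis NP : reflection_cocycle S N.
Hypothesis one_end : exactly_one_end A.

Local Notation ell := (word_length S).
Implicit Types (g h j s t u v w x y z : W).

Lemma one_end_infinite (K : seq W) : exists g, g \notin K.
Proof.
have [[r [_ /(_ K)[n hn]]] _] := one_end; exists (r n); exact: hn.
Qed.

(** Otherwise all generators are descents and [spherical_descents] bounds the length on all of W. *)
Lemma ascent_exists g : exists s, ascent S N g s.
Proof.
apply: contrapT => no.
have [K hK] := word_ball_finite S (ell (g^-1)%g).
have [x /negP[]] := one_end_infinite K; apply: hK.
have gS j : j \in (S : seq W) -> N (g^-1)%g j.
  by move=> jS; apply/negPn/negP => nj; apply: no; exists j.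
by rewrite -(spherical_descents NP (fun=> id) gS (parabolicS NP x)) leq_addr.
Qed.

(** Common descents generate a dihedral subgroup of bounded length. *)
Lemma descents_finite_order v a b : a \in (S : seq W) -> b \in (S : seq W) ->
  N v a -> N v b -> finite_order (a * b)%g.
Proof.
move=> aS bS va vb; apply: (@bounded_finite_order _ S (ell v)) => n.
have JS : gen_subset S (pred2 a b) by move=> j /orP[]/eqP->.
have abn : parabolic (pred2 a b) ((a * b) ^+ n)%g.
  elim: n => [|n IH]; first exact: parabolic1.
  rewrite expgS; apply: parabolicM IH; apply: parabolicM;
    by apply: parabolic_gen; rewrite /= eqxx ?orbT.
have vab j : pred2 a b j -> N v j by move=> /orP[]/eqP->.
by rewrite -(spherical_descents NP JS vab abn) leq_addr.
Qed.

(** * Sides of the finite subgroup generated by the descents *)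

Section Sides.
Variable g : W.

Let J : pred W := fun j => (j \in (S : seq W)) && N (g^-1)%g j.
Let JS : gen_subset S J. Proof. by move=> j /andP[]. Qed.

Lemma ascentP j : j \in (S : seq W) -> ~~ J j -> ascent S N g j.
Proof. by move=> jS; rewrite /J jS. Qed.

Lemma ascentF j : ascent S N g j -> ~~ J j.
Proof. by move=> [jS nj]; rewrite /J jS. Qed.

Definition closed_links (Q : W -> Prop) := forall a b, ascent S N g a -> ascent S N g b ->
  finite_order (a * b)%g -> Q a -> Q b.

(* The elements outside W_J, J the set of descents of g, whose minimal
   representative modulo W_J on the left starts with a letter in Q. *)
Definition side (Q : W -> Prop) w := exists u v a,
  [/\ parabolic J u, w = (u * v)%g, forall j, J j -> ~~ N v j &
      [/\ ascent S N g a, Q a & N v a]].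

(** The minimal representative v is unique, and two first letters a, b of it are linked, being
    common descents. *)
Lemma side_disjoint Q w : closed_links Q -> side Q w -> ~ side (fun a => ~ Q a) w.
Proof.
move=> clQ [u [v [a [uJ ew vJ [aa Qa va]]]]] [u' [v' [b [u'J ew' v'J [ab Qb v'b]]]]].
pose x := (u'^-1 * u)%g.
have ev : v' = (x * v)%g by rewrite /x -mulgA -ew ew' mulKg.
have ev' : v = (x^-1 * v')%g by rewrite ev mulKg.
have xJ : parabolic J x by exact: parabolicM (parabolicV NP JS u'J) uJ.
have l1 := coset_length NP JS vJ xJ.
have l2 := coset_length NP JS v'J (parabolicV NP JS xJ).
rewrite -ev in l1; rewrite -ev' in l2.
have x1 : x = 1%g by apply: (@word_length_eq0 _ S); lia.
have vv : v = v' by rewrite ev x1 mul1g.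
apply: Qb; apply: (clQ a b) => //.
by apply: (descents_finite_order (v := v)); [case: aa | case: ab | | rewrite vv].
Qed.

(** A Cayley edge that does not end in W_J cannot change sides. *)
Lemma side_step Q w c : closed_links Q -> side Q w -> c \in (S : seq W) ->
  ~ parabolic J (w * c)%g -> side Q (w * c)%g.
Proof.
move=> clQ [u [v [a [uJ ew vJ [aa Qa va]]]]] cS nwc.
have NvcE t : N (v * c)%g t = N v t (+) (t ^ v == c)%g.
  by rewrite (cocycleM NP) (cocycleS NP _ cS).
have [vcJ|] := pselect (forall j, J j -> ~~ N (v * c)%g j).
  have [e|ne] := eqVneq (a ^ v)%g c; last first.
    exists u, (v * c)%g, a; rewrite mulgA -ew; split => //.
    by split => //; rewrite NvcE va (negbTE ne).
  have vc1 : (v * c)%g <> 1%g.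
    by move=> h; apply: nwc; rewrite ew -mulgA h mulg1.
  (* The edge crosses the wall of a, so a may no longer begin v c. Another first letter b of v c is
     also a descent of v, hence linked to a. *)
  have [b [bS vcb]] := first_descent NP (fun=> id) (parabolicS NP (v * c)%g) vc1.
  have vb : N v b.
    move: vcb; rewrite NvcE; case: eqP => [eb|_]; last by rewrite addbF.
    have -> : b = a by apply: (conjg_inj v); rewrite eb e.
    by rewrite va.
  have ab : ascent S N g b by apply: ascentP => //; apply: contraL vcb; exact: vcJ.
  exists u, (v * c)%g, b; rewrite mulgA -ew; split => //; split => //.
  by apply: (clQ a b) => //; apply: (descents_finite_order (v := v)) => //; case: aa.
(* If v c is not minimal, then v c = j v for some j in J: only the W_J part u changes. *)
move=> /existsNP[j /not_implyP[jJ /negP/negPn]]; rewrite NvcE (negbTE (vJ j jJ)) /=.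
move=> /eqP jv; exists (u * j)%g, v, a; split => //.
- by apply: parabolicM => //; apply: parabolic_gen.
- by rewrite ew -jv conjgE !mulgA mulgK.
Qed.

(** A descent j of w in J would be a reflection of the subgroup generated by s and t, hence s or t
    itself, but these are ascents. *)
Lemma dihedral_not_parabolic s t w : ascent S N g s -> ascent S N g t ->
  parabolic (pred2 s t) w -> w <> 1%g -> ~ parabolic J w.
Proof.
move=> gs gt stw w1 Jw; have [j [jJ wj]] := first_descent NP JS Jw w1.
have stS : gen_subset S (pred2 s t) by move=> k /orP[]/eqP->; [case: gs | case: gt].
have [x [k [xst kst ej]]] := cocycle_parabolic NP stS stw wj.
have jst : parabolic (pred2 s t) j by rewrite ej; exact: (parabolic_reflection NP).
have := gen_parabolic NP stS (JS jJ) jst.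
by case/orP => /eqP e; move: jJ; rewrite e; apply/negP; exact: ascentF.
Qed.

(** The path s, st, sts, ... starts on side Q and never meets W_J. The exponent is positive because
    1 lies in W_J. *)
Lemma side_powers Q s t n : closed_links Q -> ascent S N g s -> ascent S N g t ->
  ~ finite_order (s * t)%g -> Q s -> side Q ((s * t) ^+ n.+1)%g.
Proof.
move=> clQ gs gt nst Qs; have [[sS _] [tS _]] := (gs, gt).
have Js : parabolic (pred2 s t) s by apply: parabolic_gen; rewrite /= eqxx.
have Jt : parabolic (pred2 s t) t by apply: parabolic_gen; rewrite /= eqxx orbT.
have Jx i : parabolic (pred2 s t) ((s * t) ^+ i)%g.
  elim: i => [|i IH]; first exact: parabolic1.
  by rewrite expgS; apply: parabolicM IH; apply: parabolicM.
have evenx i : odd (ell ((s * t) ^+ i)%g) = false.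
  elim: i => [|i IH]; first by rewrite word_length1.
  by rewrite expgSr mulgA !(odd_length NP) // negbK.
have step1 i : side Q ((s * t) ^+ i * s)%g -> side Q ((s * t) ^+ i.+1)%g.
  move=> h; rewrite expgSr mulgA; apply: side_step => //.
  rewrite -mulgA -expgSr; apply: (dihedral_not_parabolic gs gt) => // e.
  by apply: nst; exists i.+1.
elim: n => [|n IH]; apply: step1.
  rewrite mul1g; exists 1%g, s, s; rewrite mul1g; split => //; first exact: parabolic1.
    move=> j jJ; rewrite (cocycleS NP) //; apply: contraTneq jJ => ->; exact: ascentF.
  by rewrite (cocycleS NP) // eqxx.
apply: side_step => //; apply: (dihedral_not_parabolic gs gt); first exact: parabolicM.
by move/(congr1 (fun w => odd (ell w))); rewrite (odd_length NP) // evenx word_length1.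
Qed.

(** Transfers [side_step] to the generators A: an S-path from h spelling x has bounded length, so it
    can meet the finite W_J only if h lies in the finite set K. *)
Lemma side_neighbours Q k : closed_links Q -> exists K : seq W, forall h x,
  word_length A x <= k -> h \notin K -> side Q h -> side Q (h * x)%g.
Proof.
move=> clQ; have [l hl] := word_length_lipschitz A S.
have [K1 hK1] := word_ball_finite S (ell (g^-1)%g).
have [K2 hK2] := word_ball_finite S (l * k).
exists [seq (y * z)%g | y <- K1, z <- K2] => h x xk hK.
have : ell x <= l * k by apply: leq_trans (hl x) _; rewrite leq_mul2l xk orbT.
have [p [pS <- <- _]] := parabolic_word NP (fun=> id) (parabolicS NP x).
elim/last_ind: p pS => [|p c IH] pS; first by rewrite prodg_nil mulg1.
move: pS; rewrite all_rcons size_rcons => /andP[cS pS] sp Qh.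
rewrite -cats1 prodg_cat prodg1 mulgA; apply: side_step => //.
  by apply: IH => //; apply: ltnW.
move=> par; move/negP: hK; apply; apply/allpairsP.
exists (h * prodg p * c, (prodg p * c)^-1)%g; split => /=.
- have Jg j : J j -> N (g^-1)%g j by case/andP.
  by apply: hK1; rewrite -(spherical_descents NP JS Jg par) leq_addr.
- apply: hK2; rewrite word_lengthVE; apply: leq_trans sp.
  have -> : (prodg p * c)%g = prodg (rcons p c) by rewrite -cats1 prodg_cat prodg1.
  rewrite -(size_rcons p c); apply: word_length_min => //.
  by rewrite (word_over_gens NP) all_rcons cS.
by rewrite -(mulgA h) mulgK.
Qed.

End Sides.

(** If not, the powers of st and of ts run along rays on opposite sides of W_J, and a path off K
    joining the rays would have to change sides. *)
Lemma one_end_linked g s t : ascent S N g s -> ascent S N g t -> linked S N g s t.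
Proof.
move=> gs gt P Ps clP; apply: contrapT => nPt.
have clP' : closed_links g (fun a => ~ P a).
  by move=> a b ga gb ab nPa Pb; apply: nPa; apply: (clP b a) => //; apply: finite_orderC.
have nst : ~ finite_order (s * t)%g by move=> st; apply: nPt; apply: (clP s t).
have nts : ~ finite_order (t * s)%g by move=> /finite_orderC.
have [r [L [pr L0 er]]] := infinite_order_ray A nst.
have [r' [L' [pr' L0' er']]] := infinite_order_ray A nts.
have [K hK] := side_neighbours 1 (clP : closed_links g P).
have [n hn] := one_end.2 r r' pr pr' K.
have [p [path_p last_p pK]] := hn (n.+1 * L) (n.+1 * L') ltac:(nia) ltac:(nia).
apply: (side_disjoint (clP : closed_links g P) (w := r' (n.+1 * L')) _); last first.
  by rewrite er'; apply: side_powers.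
have : side g P (r (n.+1 * L)) by rewrite er; apply: side_powers.
rewrite -last_p; elim: p (r (n.+1 * L)) path_p pK {last_p hn} => [|y p IH] x //=.
move=> /andP[xy yp] /andP[xK pK] Px; apply: IH => //.
have -> : y = (x * (x^-1 * y))%g by rewrite mulVKg.
by apply: hK => //; rewrite -[_ <= _]/(word_dist A x y <= 1) (eqP xy).
Qed.

End OneEnd.

(** * The topology of the boundary *)

Definition agree (T : Type) N (f g : nat -> T) := forall i, i <= N -> f i = g i.

Section Cylinders.
Variable T : choiceType.
Implicit Types (f g : {ptws nat -> discrete_topology T}).

Lemma nbhs_cylinder f N : nbhs f [set g | agree N f g].
Proof.
have one i : nbhs f [set g : {ptws nat -> discrete_topology T} | f i = g i].
  have := @proj_continuous nat (fun=> discrete_topology T) i f [set f i].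
  rewrite /= -[X in _ -> X]/(nbhs f (proj i @^-1` [set y | f i = y])) => H.
  have -> : [set y | f i = y] = [set f i] by apply/seteqP; split => y /= ->.
  by apply: H; exact: discrete_set1.
have ff : Filter (nbhs f) by exact: nbhs_filter.
elim: N => [|N IH].
  by apply: filterS (one 0) => g e i; rewrite leqn0 => /eqP->.
apply: filterS (filterI IH (one N.+1)) => g [gN e] i.
by rewrite leq_eqVlt => /orP[/eqP->|]; [ | rewrite ltnS; exact: gN].
Qed.

(** Otherwise points outside U agreeing with f up to N would converge to f. *)
Lemma open_cylinder (U : set {ptws nat -> discrete_topology T}) f : open U -> U f ->
  exists N, forall g, agree N f g -> U g.
Proof.
move=> oO Of; apply: contrapT => no.
have {no} no N : exists g : {ptws nat -> discrete_topology T}, agree N f g /\ ~ U g.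
  apply: contrapT => h; apply: no; exists N => g fg.
  by apply: contrapT => nO; apply: h; exists g.
have [g hg] := choice no.
have : g @ \oo --> f.
  apply/cvg_sup => i B; rewrite nbhsE => -[C [[D oD <-] Cf] CB]; exists i => // N iN.
  by apply: CB; rewrite /= -((hg N).1 i iN).
move=> /(_ U (open_nbhs_nbhs (conj oO Of))) [N _ /(_ N (leqnn N))].
exact: (hg N).2.
Qed.

End Cylinders.

Section Boundary.
Variables (W : groupType) (A : genset W).

Lemma boundary_openP (U : set (gromov_boundary A)) :
  open U <-> forall x : geodesic_rays A, U (\pi x) -> exists N, forall y : geodesic_rays A,
    agree N (set_val x) (set_val y) -> U (\pi y).
Proof.
split=> [[B oB BO] x Ox|H].
  have Bx : B (set_val x) by rewrite -[B _]/((set_val @^-1` B) x) BO.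
  have [N hN] := open_cylinder oB Bx; exists N => y xy.
  rewrite -[U _]/((\pi_(gromov_boundary A) @^-1` U) y) -BO; exact: hN.
(* The open set inducing U is the union of the cylinders all of whose rays end in U. *)
exists [set f | exists (x : geodesic_rays A) N, agree N (set_val x) f /\
  forall y : geodesic_rays A, agree N (set_val x) (set_val y) -> U (\pi y)].
  rewrite openE => f [x [N [xf hN]]]; rewrite /interior.
  have ff : Filter (nbhs f) by exact: nbhs_filter.
  apply: filterS (nbhs_cylinder f N) => g fg; exists x, N; split => // i iN.
  by rewrite xf // fg.
apply/seteqP; split => [y [x [N [xy hN]]]|x Ox]; first exact: hN.
by have [N hN] := H x Ox; exists x, N.
Qed.

Lemma boundary_eqP (x y : geodesic_rays A) :
  reflect (exists C, forall n, word_dist A (set_val x n) (set_val y n) <= C)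
    (\pi_(gromov_boundary A) x == \pi y).
Proof.
apply: (iffP idP) => [/eqP/eqquotP/asboolP //|h]; apply/eqP/eqquotP; exact/asboolP.
Qed.

End Boundary.

(** * Shadows *)

Section Rays.
Variables (W : groupType) (B : genset W).
Implicit Types (r : nat -> W).

Lemma ray_steps r : r 0 = 1%g -> (forall n, word_dist B (r n) (r n.+1) <= 1) ->
  (forall n, word_length B (r n) = n) -> ray B r.
Proof.
move=> r0 r1 rl; split => // n i j ij jn.
have := @word_dist_path W B 1 n r (fun i _ => r1 i) i j ij jn.
have := word_dist_triangle B 1%g (r i) (r j); rewrite !word_dist1 !rl; lia.
Qed.

Lemma ray_limit r : (forall N, exists2 r', ray B r' & agree N r r') -> ray B r.
Proof.
move=> lim; split; first by have [r' [r'0 _] e] := lim 0; rewrite e.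
by move=> n i j ij jn; have [r' [_ gr'] e] := lim n; rewrite !e ?(gr' n) //; lia.
Qed.

Lemma geodesic_raysP r : geodesic_rays B r <-> ray B r.
Proof.
split=> -[r0 gr]; split => //; first by move=> n i j ij _; exact: gr.
by move=> m n mn; exact: (gr n).
Qed.

Lemma geodesic_rays_ray (x : geodesic_rays B) : ray B (set_val x).
Proof. by apply/geodesic_raysP; exact: set_valP. Qed.

Lemma ray_geodesic_rays r : ray B r -> exists x : geodesic_rays B, set_val x = r.
Proof. by move=> /geodesic_raysP/mem_set rB; exists (SigSub rB). Qed.

Lemma rays_cluster (r r' : nat -> nat -> W) :
  (forall k, ray B (r k)) -> (forall k, ray B (r' k)) ->
  exists s s', [/\ ray B s, ray B s' & forall N M, exists k,
    [/\ M <= k, agree N s (r k) & agree N s' (r' k)]].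
Proof.
move=> rB r'B; have [g hg] : exists g : nat -> W * W, forall N M, exists k, M <= k /\
    forall i, i <= N -> (r k i, r' k i) = g i.
  apply: (cluster_sequence (f := fun k i => (r k i, r' k i))) => i.
  have [s hs] := word_ball_finite B i; exists [seq (x, y) | x <- s, y <- s] => k.
  by apply/allpairsP; exists (r k i, r' k i); split => //=; apply: hs; rewrite ?(ray_length (rB k)) ?(ray_length (r'B k)).
have lim N M : exists k, [/\ M <= k, agree N (fun i => (g i).1) (r k) &
    agree N (fun i => (g i).2) (r' k)].
  by have [k [Mk hk]] := hg N M; exists k; split => // i /hk <-.
exists (fun i => (g i).1), (fun i => (g i).2); split => //; apply: ray_limit => N.
  by have [k [_ e _]] := lim N 0; exists (r k).
by have [k [_ _ e]] := lim N 0; exists (r' k).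
Qed.

End Rays.

Section Boundary.
Variables (W : groupType) (A A1 A2 S : genset W) (N : W -> W -> bool).
Hypotheses (hypA : hyperbolic A1) (NP : reflection_cocycle S N) (one_end : exactly_one_end A2).

Local Notation ell := (word_length S).
Local Notation asym := (asym A1).
Local Notation qray := (qray A1).
Local Notation bd := (gromov_boundary A).
Implicit Types (g h x y : W) (r s : nat -> W) (p q : bd).

Lemma common_qray : exists l, (forall r, ray A r -> qray l r) /\ (forall r, ray S r -> qray l r).
Proof.
have [l1 h1] := ray_qray A1 A; have [l2 h2] := ray_qray A1 S.
by exists (l1 + l2); split => r; [apply: h1; exact: leq_addr | apply: h2; exact: leq_addl].
Qed.

Lemma cone_ray g h : cone S g h -> exists r, [/\ ray S r, r (ell g) = g & r (ell h) = h].
Proof.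
move=> gh.
have [up hup] := choice (ascent_exists NP one_end).
have [p [pS ep sp _]] := parabolic_word NP (fun=> id) (parabolicS NP g).
have [q [qS eq sq _]] := parabolic_word NP (fun=> id) (parabolicS NP (g^-1 * h)%g).
pose w := p ++ q.
have sw : size w = ell h by rewrite size_cat sp sq -gh.
have wS : word_over S w by rewrite (word_over_gens NP) all_cat pS.
pose f x := (x * up x)%g.
(* Truncated subtraction makes r follow w first; past its end [word_path] stays at h and the ascents
   take over. *)
pose r n := iter (n - size w) f (word_path 1%g w n).
have over n : word_path 1%g w (size w + n) = h.
  rewrite /word_path mul1g take_oversize ?leq_addr // -/(prodg w) prodg_cat ep eq.
  exact: mulVKg.
have rtail n : r (size w + n) = iter n f h by rewrite /r addKn over.
have rhead n : n <= size w -> r n = word_path 1%g w n by rewrite /r -subn_eq0 => /eqP->.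
have lf x : ell (f x) = (ell x).+1 by apply: (ascent_length NP); exact: hup.
have w0 : word_path 1%g w 0 = 1%g by rewrite /word_path take0 big_nil mulg1.
have rl n : ell (r n) = n.
  have [nw|nw] := leqP n (size w).
    rewrite rhead //; have h1 := word_path_dist 1%g wS (leq0n n).
    have h2 := word_path_dist 1%g wS nw; rewrite w0 word_dist1 subn0 in h1.
    have := over 0; rewrite addn0 => ow; rewrite ow in h2.
    have := word_dist_triangle S 1%g (word_path 1%g w n) h.
    by rewrite !word_dist1 -sw; lia.
  rewrite -(subnKC (ltnW nw)) rtail; elim: (n - _) => [|k IH]; first by rewrite addn0.
  by rewrite iterS lf IH addnS.
exists r; split.
- apply: ray_steps => [|n|//]; first by rewrite rhead.
  have [nw|nw] := ltnP n (size w).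
    rewrite (rhead _ (ltnW nw)) (rhead _ nw).
    by have := word_path_dist 1%g wS (leqnSn n); rewrite subSnn.
  rewrite -(subnKC nw) -addnS !rtail iterS; set x := iter _ _ _.
  by rewrite /f /word_dist mulKg (length_gen NP (hup x).1).
- have pw : ell g <= size w by rewrite sw gh leq_addr.
  by rewrite rhead // /word_path mul1g -sp take_size_cat.
- by rewrite -sw rhead // -[X in word_path _ _ X]addn0 over.
Qed.

Lemma ray_cone r : ray S r -> forall m n, m <= n -> cone S (r m) (r n).
Proof.
move=> rS m n mn; rewrite /cone !(ray_length rS) -/(word_dist S (r m) (r n)).
by rewrite (rS.2 n) // subnKC.
Qed.

(** A relation between S-rays and points of [bd], which are classes of A-rays; it is shown below to
    be functional and onto. *)
Definition ends_at s p := exists x : geodesic_rays A, p = \pi x /\ asym s (set_val x).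

(** Points at times i and j of A-rays from 1 have lengths i and j, so closeness bounds |i - j| and
    the rays can be synchronised. *)
Lemma rays_asym_eq (x y : geodesic_rays A) :
  asym (set_val x) (set_val y) <-> \pi_bd x = \pi y.
Proof.
have rx := geodesic_rays_ray x; have ry := geodesic_rays_ray y.
split => [[H xy]|/eqP/boundary_eqP[C xy]]; last first.
  have [u hu] := word_dist_lipschitz A A1; exists (u * C) => i; exists i.
  by apply: leq_trans (hu _ _) _; rewrite leq_mul2l xy orbT.
have [u hu] := word_dist_lipschitz A1 A.
apply/eqP/boundary_eqP; exists (u * H + u * H) => i; have [j hj] := xy i.
have d1 : word_dist A (set_val x i) (set_val y j) <= u * H.
  by apply: leq_trans (hu _ _) _; rewrite leq_mul2l hj orbT.
have d2 : word_dist A (set_val y j) (set_val y i) <= u * H.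
  have t1 := word_dist_triangle A 1%g (set_val x i) (set_val y j).
  have t2 := word_dist_triangle A 1%g (set_val y j) (set_val x i).
  rewrite !word_dist1 !(ray_length rx) !(ray_length ry) in t1 t2.
  rewrite word_distC in t2.
  have [ij|ij] := leqP i j.
    by rewrite word_distC (ry.2 j) //; lia.
  by rewrite (ry.2 i) //; lia.
apply: leq_trans (word_dist_triangle _ _ (set_val y j) _) (leq_add d1 d2).
Qed.

Lemma ends_at_ex s : ray S s -> exists p, ends_at s p.
Proof.
move=> /(asymptotic_ray_exists hypA A)[a [/ray_geodesic_rays[x <-] sx]].
by exists (\pi x), x.
Qed.

Lemma ends_at_onto p : exists s, ray S s /\ ends_at s p.
Proof.
have [l [lA lS]] := common_qray.
have rx := geodesic_rays_ray (repr p : geodesic_rays A).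
have [s [sS xs]] := asymptotic_ray_exists hypA S rx.
exists s; split => //; exists (repr p); rewrite reprK; split => //.
by apply: (asym_sym hypA (lA _ rx) (lS _ sS)).
Qed.

Lemma ends_at_asym s s' p p' : ray S s -> ray S s' -> ends_at s p -> ends_at s' p' ->
  asym s s' <-> p = p'.
Proof.
have [l [lA lS]] := common_qray.
move=> /lS qs /lS qs' [x [-> sx]] [y [-> sy]].
have /lA qx := geodesic_rays_ray x; have /lA qy := geodesic_rays_ray y.
rewrite -rays_asym_eq; split=> h.
  by apply: asym_trans (asym_sym hypA qs qx sx) _; apply: asym_trans h sy.
by apply: asym_trans sx _; apply: asym_trans h (asym_sym hypA qs' qy sy).
Qed.

Lemma ends_at_unique s p p' : ray S s -> ends_at s p -> ends_at s p' -> p = p'.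
Proof. by move=> sS sp sp'; apply/(ends_at_asym sS sS sp sp'); exact: asym_refl. Qed.

Lemma ends_at_transfer s s' p : ray S s -> ray S s' -> asym s s' -> ends_at s p -> ends_at s' p.
Proof.
move=> sS s'S ss' sp; have [p' s'p'] := ends_at_ex s'S.
by have /(ends_at_asym sS s'S sp s'p') -> := ss'.
Qed.

Lemma asym_limit_ends s a : ray S s -> ray A a ->
  (forall n, exists s' a', [/\ ray S s', ray A a', agree n s s', agree n a a' & asym s' a']) ->
  asym s a.
Proof.
have [l [lA lS]] := common_qray; have [H HH] := asym_close hypA l.
move=> sS aA lim; apply: (asym_limit hypA (e := H) (lS _ sS)) => n.
have [s' [a' [s'S a'A ss' aa' s'a']]] := lim n.
have [j hj] := (HH _ _ (lS _ s'S) (lA _ a'A) s'a').1 n.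
exists s', a', n, j; split; [exact: lS | exact: lA | | | by []].
  by move=> i /ss'.
by move=> i /aa'.
Qed.

Lemma asym_limit_meet e s t : ray S s -> ray S t ->
  (forall n, exists s' t', [/\ ray S s', ray S t', agree n s s', agree n t t' &
     exists i j, n <= i /\ word_dist S (s' i) (t' j) <= e]) ->
  asym s t.
Proof.
have [l [lA lS]] := common_qray; have [u hu] := word_dist_lipschitz S A1.
move=> sS tS lim; apply: (asym_limit hypA (e := u * e) (lS _ sS)) => n.
have [s' [t' [s'S t'S ss' tt' [i [j [ni ij]]]]]] := lim n.
exists s', t', i, j; split; [exact: lS | exact: lS | | |].
- by move=> k /ss'.
- by move=> k /tt'.
- by split => //; apply: leq_trans (hu _ _) _; rewrite leq_mul2l ij orbT.
Qed.

(** Otherwise A-rays asymptotic to S-rays tending to s, with ends outside U, cluster at an A-ray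
    ending at p. *)
Lemma ends_at_continuous (U : set bd) s p : open U -> ray S s -> ends_at s p -> U p ->
  exists M, forall s' p', ray S s' -> agree M s s' -> ends_at s' p' -> U p'.
Proof.
move=> oU sS sp Up; apply: contrapT => no.
have {}no M : exists z : (nat -> W) * geodesic_rays A,
    [/\ ray S z.1, agree M s z.1, asym z.1 (set_val z.2) & ~ U (\pi z.2)].
  apply: contrapT => h; apply: no; exists M => s' p' s'S ss' [x [-> s'x]].
  by apply: contrapT => nU; apply: h; exists (s', x).
have [z hz] := choice no.
have zA k := geodesic_rays_ray (z k).2.
have [a [b [aA _ lim]]] := rays_cluster zA zA.
have [y ey] := ray_geodesic_rays aA.
have sa : asym s a.
  apply: asym_limit_ends => // n; have [k [nk ak _]] := lim n n.
  have [zS sz zz _] := hz k; exists (z k).1, (set_val (z k).2); split => //.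
  by move=> i hi; apply: sz; apply: leq_trans nk.
have py : p = \pi y.
  by apply: (ends_at_unique sS sp); exists y; rewrite ey.
have Uy : U (\pi y) by rewrite -py.
have [M hM] := (boundary_openP U).1 oU y Uy.
have [k [_ ak _]] := lim M 0; have [_ _ _] := hz k; apply; apply: hM.
by rewrite ey.
Qed.

Definition shadow g : set bd := [set p | exists s, [/\ ray S s, s (ell g) = g & ends_at s p]].

(** A limit of rays through g passes through g. *)
Lemma shadow_closed g : closed (shadow g).
Proof.
rewrite -openC; apply/boundary_openP => x nx; apply: contrapT => no; apply: nx.
have {}no M : exists z : (nat -> W) * geodesic_rays A, [/\ ray S z.1, z.1 (ell g) = g,
    asym z.1 (set_val z.2) & agree M (set_val x) (set_val z.2)].
  apply: contrapT => h; apply: no; exists M => y xy [s [sS sg [y' [yy' sy']]]].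
  apply: h; exists (s, y); split => //=.
  by apply: asym_trans sy' _; apply/rays_asym_eq.
have [z hz] := choice no.
have zS k : ray S (z k).1 by have [] := hz k.
have [s [s' [sS _ lim]]] := rays_cluster zS zS.
exists s; split => //.
  by have [k [_ sk _]] := lim (ell g) 0; rewrite sk //; have [] := hz k.
exists x; split => //; apply: asym_limit_ends => // [|n]; first exact: geodesic_rays_ray.
have [k [nk sk _]] := lim n n; have [_ _ zz xz] := hz k.
exists (z k).1, (set_val (z k).2); split => //; first exact: geodesic_rays_ray.
by move=> i hi; apply: xz; apply: leq_trans nk.
Qed.

(* A separation of the shadow would colour the rays through g.  As the cone of g
   is connected above every level, rays of both colours pass through adjacent
   vertices at arbitrarily high levels; in the limit they end at one point. *)
Lemma shadow_connected g : connected (shadow g).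
Proof.
move=> B [p0 Bp0] [C oC BC] [D cD BD].
have BS p : B p -> shadow g p by rewrite BC => -[].
apply/seteqP; split => [|p1 Sp1]; first exact: BS.
apply: contrapT => nBp1.
have [s0 [s0S s0g s0p]] := BS p0 Bp0; have [s1 [s1S s1g s1p]] := Sp1.
pose color s := exists p, ends_at s p /\ B p.
pose through s := ray S s /\ s (ell g) = g.
(* Otherwise the colour of s0 would spread along a high walk in the cone from s0 to s1. *)
have {s0 s0S s0g s0p s1 s1S s1g s1p p0 Bp0 p1 Sp1 nBp1} adj k :
    exists z : (nat -> W) * (nat -> W), [/\ through z.1, through z.2, color z.1, ~ color z.2 &
    exists i j, k <= i /\ word_dist S (z.1 i) (z.2 j) <= 1].
  apply: contrapT => no; pose m := ell g + k.
  have gcone s : through s -> cone S g (s m).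
    by move=> [sS sg]; rewrite -{1}sg; apply: ray_cone => //; exact: leq_addr.
  have t0 : through s0 by []. have t1 : through s1 by [].
  have wk : walk S (fun h => cone S g h /\ m <= ell h) (s0 m) (s1 m).
    apply: (cone_level_connected NP) => //; try exact: gcone.
    - by move=> *; exact: (one_end_linked NP one_end).
    - exact: leq_addr.
    - by rewrite (ray_length s0S).
    - by rewrite (ray_length s1S).
  have spread s t i j : through s -> through t -> color s -> k <= i ->
      word_dist S (s i) (t j) <= 1 -> color t.
    by move=> ts tt cs ki d1; apply: contrapT => nt; apply: no; exists (s, t); split => //; exists i, j.
  have colored y : walk S (fun h => cone S g h /\ m <= ell h) (s0 m) y ->
      forall s, through s -> s (ell y) = y -> color s.
    elim=> [_|y' c wy IH cS [gy' my'] s ts sy].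
      rewrite (ray_length s0S) => s ts sm.
      apply: (spread s0 s m m) => //; [by exists p0 | exact: leq_addl |].
      by rewrite sm word_dist0.
    have [gy my] := walk_end wy.
    have [r [rS rg ry]] := cone_ray gy.
    apply: (spread r s (ell y') (ell (y' * c)%g)) => //.
    - exact: IH.
    - by apply: leq_trans my; exact: leq_addl.
    - by rewrite ry sy /word_dist mulKg (length_gen NP).
  have [p [s1p' Bp]] : color s1.
    by apply: (colored _ wk) => //; rewrite (ray_length s1S).
  by apply: nBp1; rewrite (ends_at_unique s1S s1p s1p').
have [z hz] := choice adj.
have z1S k : ray S (z k).1 by have [[]] := hz k.
have z2S k : ray S (z k).2 by have [_ []] := hz k.
have [r [r' [rS r'S lim]]] := rays_cluster z1S z2S.
have rr' : asym r r'.
  apply: (asym_limit_meet (e := 1)) => // n; have [k [nk rk r'k]] := lim n n.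
  have [_ _ _ _ [i [j [ki dij]]]] := hz k.
  by exists (z k).1, (z k).2; split => //; exists i, j; split => //; apply: leq_trans ki.
have [p rp] := ends_at_ex rS; have r'p := ends_at_transfer rS r'S rr' rp.
have Sp : shadow g p.
  exists r; split => //; have [k [_ rk _]] := lim (ell g) 0; rewrite rk //.
  by have [[]] := hz k.
(* If p is in B, openness of C colours some (z k).2; if not, p is outside the closed D and some (z
   k).1 is not coloured. *)
have [Bp|nBp] := pselect (B p).
  have Cp : C p by move: Bp; rewrite BC => -[].
  have [M hM] := ends_at_continuous oC r'S r'p Cp.
  have [k [_ _ r'k]] := lim M 0; have [_ [_ zg] _ nc _] := hz k.
  have [q zq] := ends_at_ex (z2S k); apply: nc; exists q; split => //.
  rewrite BC; split; last exact: hM zq.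
  by exists (z k).2.
have nDp : (~` D) p by move=> Dp; apply: nBp; rewrite BD.
have [M hM] := ends_at_continuous (closed_openC cD) rS rp nDp.
have [k [_ rk _]] := lim M 0; have [_ _ [q [zq Bq]] _ _] := hz k.
by have := hM _ _ (z1S k) rk zq; apply; move: Bq; rewrite BD => -[].
Qed.

(** * Connected neighbourhoods of boundary points *)

Lemma ray_shadow s p n : ray S s -> ends_at s p -> shadow (s n) p.
Proof. by move=> sS sp; exists s; rewrite (ray_length sS). Qed.

Definition star n p : set bd := [set q | exists g, [/\ ell g = n, shadow g p & shadow g q]].

Lemma star_center n p : star n p p.
Proof.
have [s [sS sp]] := ends_at_onto p; exists (s n); split; last exact: ray_shadow.
  exact: ray_length sS _.
exact: ray_shadow.
Qed.

Lemma star_connected n p : connected (star n p).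
Proof.
have -> : star n p = \bigcup_(g in [set g | ell g = n /\ shadow g p]) shadow g.
  by apply/seteqP; split => [q [g [gn gp gq]]|q [g [gn gp] gq]]; exists g.
by apply: bigcup_connected => [|g _]; [exists p => g [] | exact: shadow_connected].
Qed.

(** Every q lies in some shadow of level n, so removing the finitely many closed shadows that miss p
    leaves only points of the star. *)
Lemma star_nbhs n p : nbhs p (star n p).
Proof.
have [K hK] := word_ball_finite S n.
have oK (L : seq W) : open [set q | forall g, g \in L -> ~ shadow g p -> ~ shadow g q].
  elim: L => [|g L IH].
    by rewrite (_ : [set _ | _] = setT); [exact: openT | apply/seteqP; split].
  have -> : [set q | forall h, h \in g :: L -> ~ shadow h p -> ~ shadow h q] =
      (if pselect (shadow g p) then setT else ~` shadow g) `&`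
      [set q | forall g, g \in L -> ~ shadow g p -> ~ shadow g q].
    apply/seteqP; split => [q hq|q [gq hq] h].
      split; first by case: pselect => //= ngp; apply: hq => //; exact: mem_head.
      by move=> h hL; apply: hq; rewrite inE hL orbT.
    rewrite inE => /orP[/eqP->|]; last exact: hq.
    by move: gq; case: pselect.
  apply: openI => //; case: pselect => h; first exact: openT.
  by apply: closed_openC; exact: shadow_closed.
have pK : [set q | forall g, g \in K -> ~ shadow g p -> ~ shadow g q] p by move=> g.
apply: filterS (open_nbhs_nbhs (conj (oK K) pK)) => q hq.
have [s [sS sq]] := ends_at_onto q.
have gq := ray_shadow n sS sq; have gn := ray_length sS n.
exists (s n); split => //; apply: contrapT => ngp.
by apply: (hq (s n)) => //; apply: hK; rewrite gn.
Qed.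

(** Otherwise for each n a ray to p and a ray to a point outside U share their vertex at level n;
    their limits are asymptotic, so both end at p. *)
Lemma star_small (U : set bd) p : open U -> U p -> exists n, star n p `<=` U.
Proof.
move=> oU Up; apply: contrapT => no.
have {}no n : exists z : (nat -> W) * (nat -> W), [/\ ray S z.1, ray S z.2,
    z.1 n = z.2 n, ends_at z.1 p & exists q, ends_at z.2 q /\ ~ U q].
  apply: contrapT => h; apply: no; exists n => q [g [gn [s [sS sg sp]] [t [tS tg tq]]]].
  apply: contrapT => nUq; apply: h; exists (s, t); split => //; last by exists q.
  by rewrite /= -gn sg tg.
have [z hz] := choice no.
have z1S k : ray S (z k).1 by have [] := hz k.
have z2S k : ray S (z k).2 by have [] := hz k.
have [r [r' [rS r'S lim]]] := rays_cluster z1S z2S.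
have rr' : asym r r'.
  apply: (asym_limit_meet (e := 0)) => // n; have [k [nk rk r'k]] := lim n n.
  have [_ _ zz _ _] := hz k.
  by exists (z k).1, (z k).2; split => //; exists k, k; rewrite zz word_dist0.
have rp : ends_at r p.
  have [_ _ _ [x [px _]] _] := hz 0; exists x; split => //.
  apply: asym_limit_ends => // [|n]; first exact: geodesic_rays_ray.
  have [k [_ rk _]] := lim n 0; have [_ _ _ [y [py zy]] _] := hz k.
  exists (z k).1, (set_val x); split => //; first exact: geodesic_rays_ray.
  by apply: asym_trans zy _; apply/rays_asym_eq; rewrite -py.
have [M hM] := ends_at_continuous oU r'S (ends_at_transfer rS r'S rr' rp) Up.
have [k [_ _ r'k]] := lim M 0; have [_ _ _ _ [q [zq]]] := hz k.
by apply; exact: hM zq.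
Qed.

(** Stars are only shown to be neighbourhoods of their centres, so the open connected set is a
    component of V: it contains a star about each of its points. *)
Lemma boundary_locally_connected : locally_connected bd.
Proof.
move=> x U; rewrite nbhsE => -[V [oV Vx] VU].
exists (connected_component V x); split.
- rewrite openE => y Cy; rewrite /interior.
  have Vy : V y by apply: connected_component_sub Cy.
  have [n nV] := star_small oV Vy.
  apply: filterS (star_nbhs n y) => z yz.
  rewrite (same_connected_component Cy).
  exact: (connected_component_max (star_center n y) nV (@star_connected n y)) yz.
- exact: connected_component_refl.
- exact: component_connected.
- by apply: subset_trans VU; exact: connected_component_sub.
Qed.

End Boundary.

Theorem corollary6p7 (W : groupType) (cW : coxeter_group W)
    (eW : one_ended W) (hW : word_hyperbolic W) (A : genset W) :
  locally_connected (gromov_boundary A).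
Proof.
have [S [N NP]] := coxeter_reflection_cocycle cW.
have [A2 one_end] := eW; have [A1 hypA] := hW.
exact: (boundary_locally_connected (A := A) hypA NP one_end).
Qed.
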